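(* Let $\mathbf{H}$ be a variety of finite groups that is closed under extension and contains $\mathbb{Z}/p\mathbb{Z}$ for infinitely many primes $p$. Let $\overline{\mathbf{H}}$ be the variety of finite monoids all of whose subgroups belong to $\mathbf{H}$, and let $X$ be a finite set of cardinality at least two. Let $G$ be the maximal subgroup of the minimal ideal of the free pro-$\overline{\mathbf{H}}$ monoid $\widehat{F}_{\overline{\mathbf{H}}}(X)$, and let $\varphi:G\twoheadrightarrow \widehat{F}_{\mathbf{H}}(X)$ be the canonical epimorphism onto the free pro-$\mathbf{H}$ group generated by $X$, i.e. the restriction to $G$ of the canonical projection $\pi:\widehat{F}_{\overline{\mathbf{H}}}(X)\to\widehat{F}_{\mathbf{H}}(X)$. Then $\ker\varphi$ is a free pro-$\mathbf{H}$ group of countable rank.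
   Context: A variety of finite groups is a class of finite groups closed under (finite) direct products, subgroups and quotient groups; it is closed under extension if a finite group $G$ with a normal subgroup $N$ belongs to it whenever $N$ and $G/N$ do. A variety of finite monoids is defined analogously (closed under finite direct products, submonoids and homomorphic images). The subgroups of a monoid are its subsemigroups that are groups (their identity need not be the identity of the monoid). For a variety $\mathbf{V}$ of finite monoids (in particular of finite groups), $\widehat{F}_{\mathbf{V}}(X)$ denotes the free pro-$\mathbf{V}$ monoid generated by $X$: every map from $X$ to a pro-$\mathbf{V}$ monoid (projective limit of members of $\mathbf{V}$) extends uniquely to a continuous monoid homomorphism from $\widehat{F}_{\mathbf{V}}(X)$. Thus $\widehat{F}_{\mathbf{H}}(X)$ is the free pro-$\mathbf{H}$ group on the finite set $X$. The canonical projection $\pi:\widehat{F}_{\overline{\mathbf{H}}}(X)\to\widehat{F}_{\mathbf{H}}(X)$ is the continuous homomorphism that is the identity on $X$; its restriction to the maximal subgroup $G$ below is known to be onto. Every profinite monoid $M$ has a unique minimal (two-sided) ideal $I$; it is closed and contains an idempotent. For an idempotent $e\in I$, the maximal subgroup of $I$ at $e$ is the group of units $G_e$ of $eMe$; it equals $eIe$, is a closed subgroup (hence a profinite group), and is independent of the choice of $e$ up to isomorphism; $G$ denotes $G_e$ for some idempotent $e$ of the minimal ideal. A subset $Y$ of a profinite group converges to the identity if each neighbourhood of the identity contains all but finitely many elements of $Y$. A pro-$\mathbf{H}$ group $F$ is free pro-$\mathbf{H}$ on a subset $Y\subseteq F$ converging to the identity if every map $\tau:Y\to H$ with $H$ a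 pro-$\mathbf{H}$ group and $\tau(Y)$ converging to the identity extends uniquely to a continuous homomorphism $F\to H$. Free pro-$\mathbf{H}$ of countable rank means free pro-$\mathbf{H}$ on a countably infinite subset converging to the identity. *)

(* Defs.v *)
From HB Require Import structures.
From mathcomp Require Import all_boot all_order all_algebra all_fingroup.
From mathcomp Require Import all_classical topology.

Set Implicit Arguments.
Unset Strict Implicit.
Unset Printing Implicit Defensive.

Local Open Scope group_scope.
Local Open Scope classical_set_scope.

(** * Varieties of finite groups and finite monoids *)

Record group_variety (H : finGroupType -> Prop) : Prop := GroupVariety {
  variety_iso : forall gT rT : finGroupType,
    [set: gT]%SET \isog [set: rT]%SET -> H gT -> H rT;
  variety_prod : forall gT rT : finGroupType,
    H gT -> H rT -> H (gT * rT)%type;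
  variety_sub : forall (gT : finGroupType) (K : {group gT}),
    H gT -> H (subg_of K);
  variety_quo : forall (gT : finGroupType) (N : {group gT}),
    N <| [set: gT]%SET -> H gT -> H (coset_of N)
}.

Definition extension_closed (H : finGroupType -> Prop) : Prop :=
  forall (gT : finGroupType) (N : {group gT}),
    N <| [set: gT]%SET -> H (subg_of N) -> H (coset_of N) -> H gT.

(** The identity of the subgroup [A] need not be that of [M]. *)
Definition is_subgroup (M : monoidType) (A : set M) : Prop :=
  (forall x y, A x -> A y -> A (x * y)) /\
  exists2 e, A e &
    forall x, A x -> [/\ e * x = x, x * e = x &
      exists2 y, A y & x * y = e /\ y * x = e].

(** The subset [A], with the multiplication of [M], is (isomorphic to) a group
    in the class [H]. *)
Definition group_in (H : finGroupType -> Prop) (M : monoidType)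
    (A : set M) : Prop :=
  exists2 gT : finGroupType, H gT &
    exists f : gT -> M,
      [/\ injective f, {morph f : x y / x * y} & range f = A].

(** Classes of finite monoids are predicates on [monoidType] which imply
    finiteness; [as_monoids H] consists of the members of [H], regarded as
    monoids. *)
Definition as_monoids (H : finGroupType -> Prop) (M : monoidType) : Prop :=
  group_in H [set: M].

Definition bar (H : finGroupType -> Prop) (M : monoidType) : Prop :=
  finite_set [set: M] /\ forall A : set M, is_subgroup A -> group_in H A.

(** * Topological monoids and groups *)

HB.mixin Record isTopMonoid M of Topological M & Monoid M := {
  mulg_continuous : continuous (fun z : M * M => z.1 * z.2)
}.

#[short(type="topMonoidType")]
HB.structure Definition TopMonoid :=
  { M of Topological M & Monoid M & isTopMonoid M }.

HB.mixin Record isTopGroup G of Topological G & monoid.Group G := {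
  invg_continuous : continuous (fun x : G => x^-1)
}.

#[short(type="topGroupType")]
HB.structure Definition TopGroup :=
  { G of TopMonoid G & monoid.Group G & isTopGroup G }.

(** The projective limits of finite monoids satisfy these properties; making
    them part of the structure is what provides the continuity of the inverse
    in the maximal subgroups below. *)
HB.mixin Record isProfinite M of Topological M := {
  profinite_compact : compact [set: M];
  profinite_hausdorff : hausdorff_space M;
  profinite_disconnected : totally_disconnected [set: M]
}.

#[short(type="profiniteMonoidType")]
HB.structure Definition ProfiniteMonoid :=
  { M of TopMonoid M & isProfinite M }.

(** Between groups, these are the continuous group homomorphisms. *)
Record cmorph (M N : topMonoidType) := CMorph {
  cmorph_fun :> M -> N;
  cmorphP : monoid_morphism cmorph_fun;
  cmorph_continuous : continuous cmorph_fun
}.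

(** * Projective limits *)

(** Only the values [conn i j] with [idx_le i j] are meaningful. *)
Record proj_system (V : monoidType -> Prop) := ProjSystem {
  idx : Type;
  idx_le : idx -> idx -> Prop;
  idx_le_refl : forall i, idx_le i i;
  idx_le_trans : forall i j k, idx_le i j -> idx_le j k -> idx_le i k;
  idx_inhabited : inhabited idx;
  idx_directed : forall i j, exists k, idx_le i k /\ idx_le j k;
  obj : idx -> monoidType;
  objP : forall i, V (obj i);
  conn : forall i j, obj j -> obj i;
  conn_morph : forall i j, idx_le i j -> monoid_morphism (@conn i j);
  conn_id : forall i (x : obj i), conn i x = x;
  conn_comp : forall i j k, idx_le i j -> idx_le j k ->
    forall x : obj k, conn i (conn j x) = conn i x
}.

Definition threads V (S : proj_system V) :
    set (prod_topology (fun i : idx S => discrete_topology (obj i))) :=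
  [set x | forall i j, idx_le i j -> conn i (x j : obj j) = x i].
Arguments threads {V} S _.

(** [M] is isomorphic, as a topological monoid, to the submonoid [threads S]
    of the product of the discrete monoids [obj i]. *)
Definition is_proj_limit V (S : proj_system V) (M : topMonoidType) : Prop :=
  exists f : M -> prod_topology (fun i : idx S => discrete_topology (obj i)),
    [/\ forall i, monoid_morphism (fun x => f x i : obj i),
        injective f,
        range f = threads S &
        forall U : set M, open U <-> exists2 W, open W & f @^-1` W = U].

Definition pro (V : monoidType -> Prop) (M : topMonoidType) : Prop :=
  exists S : proj_system V, is_proj_limit S M.

(** * Free objects *)

Definition free_pro (V : monoidType -> Prop) (X : Type)
    (F : topMonoidType) (iota : X -> F) : Prop :=
  pro V F /\
  forall M : topMonoidType, pro V M ->
  forall tau : X -> M,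
    exists! f : cmorph F M, forall x, f (iota x) = tau x.

(** Convergence to the identity of an indexed family; a subset [Y] is the
    family [set_val : Y -> G]. *)
Definition cvg_to_one (I : Type) (G : topGroupType) (y : I -> G) : Prop :=
  forall U : set G, nbhs 1 U -> finite_set [set i | ~ U (y i)].

(** For a map [tau] on [Y], "[tau(Y)] converges to the identity" refers to the
    family of values: a nontrivial constant map on an infinite [Y] has finite
    image but never extends continuously. *)
Definition free_pro_group_on (H : finGroupType -> Prop) (G : topGroupType)
    (Y : set G) : Prop :=
  [/\ pro (as_monoids H) G,
      cvg_to_one (set_val : Y -> G) &
      forall K : topGroupType, pro (as_monoids H) K ->
      forall tau : Y -> K, cvg_to_one tau ->
        exists! f : cmorph G K, forall y : Y, f (set_val y) = tau y].

Definition free_pro_group_of_countable_rank (H : finGroupType -> Prop)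
    (G : topGroupType) : Prop :=
  exists2 Y : set G, (Y #= [set: nat])%card & free_pro_group_on H Y.

(** * The minimal ideal and its maximal subgroups *)

Definition ideal (M : monoidType) (I : set M) : Prop :=
  I !=set0 /\ forall a x b : M, I x -> I (a * x * b).

Definition minimal_ideal (M : monoidType) (I : set M) : Prop :=
  ideal I /\ forall J : set M, ideal J -> J `<=` I -> J = I.

Record idem_elt (M : monoidType) := IdemElt {
  idem_val :> M;
  idemP : idem_val * idem_val = idem_val
}.

Definition corner (M : monoidType) (e : M) : set M :=
  [set e * x * e | x in [set: M]].

Definition corner_units (M : monoidType) (e : M) : set M :=
  [set x | corner e x /\ exists2 y, corner e y & x * y = e /\ y * x = e].

Definition max_subgroup (M : monoidType) (e : idem_elt M) : Type :=
  set_type (corner_units (idem_val e)).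

(** The group structure has identity [e]. *)
Section MaxSubgroup.
Variables (M : monoidType) (e : idem_elt M).
Local Notation G := (max_subgroup e).

Lemma cornerP (x : M) :
  corner (idem_val e) x <-> idem_val e * x = x /\ x * idem_val e = x.
Proof.
split=> [[y _ <-]|[ex xe]]; last by exists x => //; rewrite ex xe.
by rewrite -!mulgA idemP !mulgA idemP.
Qed.

HB.instance Definition _ := Choice.on G.

Lemma max_subgroup_inj (x y : G) : val x = val y -> x = y.
Proof. exact: val_inj. Qed.

Lemma corner_units1 : corner_units (idem_val e) (idem_val e).
Proof.
have ce : corner (idem_val e) e by apply/cornerP; rewrite idemP.
by split=> //; exists (idem_val e) => //; rewrite idemP.
Qed.

Lemma corner_unitsM (x y : M) :
  corner_units (idem_val e) x -> corner_units (idem_val e) y ->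
  corner_units (idem_val e) (x * y).
Proof.
move=> [/cornerP[ex xe] [x' /cornerP[ex' xe'] [xx' x'x]]].
move=> [/cornerP[ey ye] [y' /cornerP[ey' ye'] [yy' y'y]]].
split; first by apply/cornerP; rewrite mulgA ex -mulgA ye.
exists (y' * x'); first by apply/cornerP; rewrite mulgA ey' -mulgA xe'.
split.
  by rewrite -mulgA [y * _]mulgA yy' ex' xx'.
by rewrite -mulgA [x' * _]mulgA x'x ey y'y.
Qed.

Lemma max_subgroup_inv_ex (x : G) : exists y : G,
  val x * val y = idem_val e /\ val y * val x = idem_val e.
Proof.
have [cx [y cy [xy yx]]] := set_valP x.
have uy : corner_units (idem_val e) y by split=> //; exists (val x).
by exists (SigSub (mem_set uy)).
Qed.

Definition max_subgroup_mul (x y : G) : G :=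
  SigSub (mem_set (corner_unitsM (set_valP x) (set_valP y))).
Definition max_subgroup_one : G := SigSub (mem_set corner_units1).
Definition max_subgroup_inv (x : G) : G :=
  projT1 (cid (max_subgroup_inv_ex x)).

Lemma max_subgroup_mulA : associative max_subgroup_mul.
Proof. by move=> x y z; apply: max_subgroup_inj; rewrite /= mulgA. Qed.

Lemma max_subgroup_mul1g : left_id max_subgroup_one max_subgroup_mul.
Proof.
move=> x; apply: max_subgroup_inj => /=.
by have [/cornerP[]] := set_valP x.
Qed.

Lemma max_subgroup_mulg1 : right_id max_subgroup_one max_subgroup_mul.
Proof.
move=> x; apply: max_subgroup_inj => /=.
by have [/cornerP[]] := set_valP x.
Qed.

Lemma max_subgroup_mulVg :
  left_inverse max_subgroup_one max_subgroup_inv max_subgroup_mul.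
Proof.
move=> x; apply: max_subgroup_inj => /=.
by rewrite /max_subgroup_inv; case: cid => y [].
Qed.

Lemma max_subgroup_mulgV :
  right_inverse max_subgroup_one max_subgroup_inv max_subgroup_mul.
Proof.
move=> x; apply: max_subgroup_inj => /=.
by rewrite /max_subgroup_inv; case: cid => y [].
Qed.

HB.instance Definition _ := isGroup.Build G max_subgroup_mulA
  max_subgroup_mul1g max_subgroup_mulg1 max_subgroup_mulVg max_subgroup_mulgV.

End MaxSubgroup.

Section SubsetTopology.
Variables (T U : topologicalType) (A : set T).

Lemma set_type_val_continuous : continuous (val : set_type A -> T).
Proof. exact: (@initial_continuous (set_type A) T set_val). Qed.

Lemma continuous_to_set_type (g : U -> set_type A) :
  continuous (fun u => val (g u)) -> continuous g.
Proof.
move=> cg; apply/continuousP => _ [B oB <-].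
by move/continuousP: cg => /(_ B oB).
Qed.

End SubsetTopology.

Lemma continuous_mulg (T : topologicalType) (M : topMonoidType) (f g : T -> M) :
  continuous f -> continuous g -> continuous (fun x => f x * g x).
Proof.
move=> cf cg x; apply: (@continuous_comp T (M * M)%type M
  (fun x => (f x, g x)) (fun z => z.1 * z.2)); last exact: mulg_continuous.
by apply: cvg_pair; [exact: cf|exact: cg].
Qed.

HB.instance Definition _ (M : topMonoidType) (e : idem_elt M) :=
  Topological.copy (max_subgroup e) (set_type (corner_units (idem_val e))).

Lemma max_subgroup_mul_continuous (M : topMonoidType) (e : idem_elt M) :
  continuous (fun z : max_subgroup e * max_subgroup e => z.1 * z.2).
Proof.
apply: (@continuous_to_set_type M (max_subgroup e * max_subgroup e)%type).
apply: continuous_mulg => z.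
  apply: (@continuous_comp _ (max_subgroup e)); first exact: cvg_fst.
  exact: set_type_val_continuous.
apply: (@continuous_comp _ (max_subgroup e)); first exact: cvg_snd.
exact: set_type_val_continuous.
Qed.

HB.instance Definition _ (M : topMonoidType) (e : idem_elt M) :=
  isTopMonoid.Build (max_subgroup e) (@max_subgroup_mul_continuous M e).

Lemma hausdorff_separate (T : topologicalType) (x y : T) :
  hausdorff_space T ->
  (forall P Q, nbhs x P -> nbhs y Q -> exists z, P z /\ Q z) -> x = y.
Proof. by move=> hT h; apply: hT => P Q Px Qy; exact: h. Qed.

Section MaxSubgroupInv.
Variables (M : profiniteMonoidType) (e : idem_elt M).
Local Notation G := (max_subgroup e).

Lemma max_subgroup_inv_continuous : continuous (fun x : G => x^-1).
Proof.
apply: (@continuous_to_set_type M G) => x.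
have ev (g : G) : idem_val e * val g = val g.
  by have [/cornerP[]] := set_valP g.
have gV (g : G) : val g * val g^-1 = idem_val e.
  by rewrite -[LHS]/(val (g * g^-1)) mulgV.
have Vg (g : G) : val g^-1 * val g = idem_val e.
  by rewrite -[LHS]/(val (g^-1 * g)) mulVg.
have mulc (y z : M) (P : set M) : nbhs (y * z) P ->
    exists A B, [/\ nbhs y A, nbhs z B & forall a b, A a -> B b -> P (a * b)].
  move=> /(@mulg_continuous M (y, z))[[A B] /= [yA zB] AB].
  by exists A, B; split=> // a b Aa Bb; apply: (AB (a, b)).
have hM := @profinite_hausdorff M.
apply: (@compact_cluster_set1 M (val x^-1)
  ((fun g : G => val g^-1) @ nbhs x) setT) => //.
- exact: profinite_compact.
- exact: filterT.
- exact: filterT.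
apply/seteqP; split=> [y cly|_ -> P Q Px Qx]; last first.
  exists (val x^-1); split; [exact: (nbhs_singleton Px)|].
  exact: nbhs_singleton Qx.
have xy : val x * y = idem_val e.
  apply: (hausdorff_separate hM) => P Q /mulc[A [B [xA yB AB]]] eQ.
  have FA : ((fun g : G => val g^-1) @ nbhs x)
      [set val g^-1 | g in [set g : G | A (val g)]].
    have : nbhs x [set g : G | A (val g)] by exact: set_type_val_continuous.
    by apply: filterS => g Ag; exists g.
  have [_ [[g Ag <-] Bg]] := cly _ _ FA yB.
  exists (idem_val e); split; last exact: nbhs_singleton.
  by rewrite -(gV g); exact: AB.
have ey : idem_val e * y = y.
  apply: (hausdorff_separate hM) => P Q /mulc[A [B [eA yB AB]]] yQ.
  have FG : ((fun g : G => val g^-1) @ nbhs x) (range (fun g : G => val g^-1)).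
    have : nbhs x [set: G] by exact: filterT.
    by apply: filterS => g _; exists g.
  have [_ [[g _ <-] [Bg Qg]]] := cly _ _ FG (filterI yB yQ).
  exists (val g^-1); split=> //.
  by rewrite -(ev g^-1); apply: AB => //; exact: nbhs_singleton.
have ve : val x^-1 * idem_val e = val x^-1 by have [/cornerP[]] := set_valP x^-1.
have -> : y = val x^-1 * val x * y by rewrite Vg ey.
by rewrite -mulgA xy ve.
Qed.

HB.instance Definition _ := isTopGroup.Build G max_subgroup_inv_continuous.

End MaxSubgroupInv.

(** * Kernels *)

Definition cmorph_ker (G K : topGroupType) (phi : cmorph G K) : Type :=
  set_type [set g : G | phi g = 1].

Section Ker.
Variables (G K : topGroupType) (phi : cmorph G K).
Local Notation N := (cmorph_ker phi).

HB.instance Definition _ :=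
  Topological.copy N (set_type [set g : G | phi g = 1]).

Lemma ker_inj (x y : N) : val x = val y -> x = y.
Proof. exact: val_inj. Qed.

Lemma ker1 : phi 1 = 1.
Proof. exact: (cmorphP phi).1. Qed.

Lemma kerM (x y : G) : phi x = 1 -> phi y = 1 -> phi (x * y) = 1.
Proof. by move=> px py; rewrite (cmorphP phi).2 px py mulg1. Qed.

Lemma kerV (x : G) : phi x = 1 -> phi x^-1 = 1.
Proof. by move=> px; rewrite -[LHS]mul1g -{1}px -(cmorphP phi).2 mulgV ker1. Qed.

Definition ker_mul (x y : N) : N :=
  SigSub (mem_set (kerM (set_valP x) (set_valP y))).
Definition ker_one : N := SigSub (mem_set ker1).
Definition ker_inv (x : N) : N := SigSub (mem_set (kerV (set_valP x))).

Lemma ker_mulA : associative ker_mul.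
Proof. by move=> x y z; apply: ker_inj; rewrite /= mulgA. Qed.
Lemma ker_mul1g : left_id ker_one ker_mul.
Proof. by move=> x; apply: ker_inj; rewrite /= mul1g. Qed.
Lemma ker_mulg1 : right_id ker_one ker_mul.
Proof. by move=> x; apply: ker_inj; rewrite /= mulg1. Qed.
Lemma ker_mulVg : left_inverse ker_one ker_inv ker_mul.
Proof. by move=> x; apply: ker_inj; rewrite /= mulVg. Qed.
Lemma ker_mulgV : right_inverse ker_one ker_inv ker_mul.
Proof. by move=> x; apply: ker_inj; rewrite /= mulgV. Qed.

HB.instance Definition _ := isGroup.Build N
  ker_mulA ker_mul1g ker_mulg1 ker_mulVg ker_mulgV.

Lemma ker_mul_continuous : continuous (fun z : N * N => z.1 * z.2).
Proof.
apply: (@continuous_to_set_type G (N * N)%type).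
apply: continuous_mulg => z.
  by apply: (@continuous_comp _ N);
    [exact: cvg_fst|exact: set_type_val_continuous].
by apply: (@continuous_comp _ N);
  [exact: cvg_snd|exact: set_type_val_continuous].
Qed.

HB.instance Definition _ := isTopMonoid.Build N ker_mul_continuous.

Lemma ker_inv_continuous : continuous (fun x : N => x^-1).
Proof.
apply: (@continuous_to_set_type G N) => x.
apply: (@continuous_comp N G G val (fun g => g^-1)).
  exact: set_type_val_continuous.
exact: invg_continuous.
Qed.

HB.instance Definition _ := isTopGroup.Build N ker_inv_continuous.

End Ker.

(** The restriction of [pi] to a maximal subgroup. *)
Section Restriction.
Variables (M : profiniteMonoidType) (e : idem_elt M) (K : topGroupType).
Variable pi : cmorph M K.

Definition max_subgroup_res_fun (g : max_subgroup e) : K := pi (val g).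

Lemma max_subgroup_res_morph : monoid_morphism max_subgroup_res_fun.
Proof.
split=> [|x y]; last exact: (cmorphP pi).2.
by apply: (mulgI (pi (idem_val e))); rewrite mulg1 -(cmorphP pi).2 idemP.
Qed.

Lemma max_subgroup_res_continuous : continuous max_subgroup_res_fun.
Proof.
move=> x; apply: (@continuous_comp (max_subgroup e) M K val pi).
  exact: set_type_val_continuous.
exact: cmorph_continuous.
Qed.

Definition max_subgroup_res : cmorph (max_subgroup e) K :=
  CMorph max_subgroup_res_morph max_subgroup_res_continuous.

End Restriction.

(* Main.v *)
From HB Require Import structures.
Require Import Defs.
From mathcomp Require Import all_boot all_order all_algebra all_fingroup.
From mathcomp Require Import all_classical topology finmap zify.

(** Write [F] for the free pro-[bar H] monoid, [e] for an idempotent of its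
    minimal ideal, [N] for the kernel in question: the elements [z] of the
    group [e F e] with [pi z = 1].  By compactness and density everything
    about [F] can be tested on finite quotients, and a property seen by one
    finite quotient holds on [F] as soon as it holds for the words in [X]
    ([word_ind]).

    The freeness criterion is that of Iwasawa ([iwasawa]): a pro-[H] group with
    countably many finite levels is free of countable rank when every embedding
    problem [N ->> B <<- A] with [A] in [H] has a surjective solution.  A basis
    is the limit of generating tuples of a chain of finite quotients of [N];
    the chain alternates between refining the quotient, so that it exhausts
    the levels of [N], and solving an embedding problem, so that every map of
    the tuple to a group in [H] gets realized.

    To solve embedding problems, homomorphisms out of [N] are described by
    automata.  If [F] acts on a finite set [Om] through a monoid in [bar H], and
    [A] is in [H], then arbitrary outputs [a s x] in [A], for a state [s] and a
    letter [x], extend to a continuous cocycle on [F]: the wreath product is again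
    in [bar H], because [H] is closed under extension ([wreath_bar],
    [cocycle_exists]).  If moreover [N] fixes a state [s0], the output read from
    [s0] is a homomorphism on [N].  Conversely every continuous homomorphism
    from [N] to a finite group arises in this way, the states being cosets of
    the image of [N] in a finite quotient of [F] ([cocycle_represents]).  Lifting
    the outputs letter by letter through [A ->> B] gives a weak solution
    ([projective]).

    A weak solution is made surjective one element at a time ([enlarge]).  Let
    [l] be in the kernel of [A ->> B].  Multiply the states by a clock which
    counts the letters [x0] up to a bound and which every other letter resets, and
    insert a conjugate of [l] into the output of the letter [y0] at a single pair
    (state, time).  As [y0] resets the clock, the words [y0 x0^(m+jd) y0], where
    [d] is a period of [x0] on the old states, end in the same pair for all [j],
    while the insertion affects [j = 0] only.  Quotients of such words, which
    make sense in the group [e F e], yield two elements with the same image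
    under [pi] whose outputs differ by [l]; since two elements with the same image
    under [pi] and the same end state have outputs differing by an output of [N]
    ([holonomy_null]), [l] is an output of [N].  Finally all conjugates of
    [l] that were inserted are outputs of [N] ([holonomy_conj]), so all the old
    outputs of [N] are still there. *)

Set Implicit Arguments.
Unset Strict Implicit.
Unset Printing Implicit Defensive.

Local Open Scope group_scope.

(** * Closure properties of a variety of finite groups *)

Lemma inj_isog_subg (gT rT : finGroupType) (f : gT -> rT) :
  injective f -> {morph f : x y / x * y} ->
  exists K : {group rT}, [set: subg_of K] \isog [set: gT].
Proof.
move=> injf fM; pose fm := Morphism (D := [set: gT]) (fun x y _ _ => fM x y).
have injm : 'injm fm by apply/injmP => x y _ _ /injf.
exists (fm @* [set: gT])%G.
apply: isog_trans (isog_symr (sub_isog (subxx _) injm)).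
by rewrite isog_sym; exact: isog_subg.
Qed.

Section GroupVariety.
Variables (H : finGroupType -> Prop) (VH : group_variety H).

Lemma variety_inj (gT rT : finGroupType) (f : gT -> rT) :
  injective f -> {morph f : x y / x * y} -> H rT -> H gT.
Proof.
move=> injf fM HrT; have [K isoK] := inj_isog_subg injf fM.
by apply: (variety_iso VH isoK); exact: variety_sub.
Qed.

(** Extension-closure in the form used below: the quotient is given as a group
    mapped to, and the kernel is handled through any subgroup of it. *)
Lemma variety_ext (HE : extension_closed H) (gT rT : finGroupType) (f : gT -> rT) :
  {morph f : x y / x * y} -> H rT ->
  (forall K : {group gT}, (forall x, x \in K -> f x = 1) -> H (subg_of K)) ->
  H gT.
Proof.
move=> fM HrT HK; pose fm := Morphism (D := [set: gT]) (fun x y _ _ => fM x y).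
have nK : 'ker fm <| [set: gT] by exact: ker_normal.
apply: (HE gT ('ker fm)%G nK); first by apply: HK => x /mker.
have /isogP[g injg gE] : [set: coset_of ('ker fm)] \isog fm @* [set: gT].
  by rewrite -quotientT; exact: first_isog.
apply: (@variety_inj _ _ g) HrT => [x y|x y]; last by rewrite morphM ?inE.
by move/injmP: injg => /(_ x y); rewrite !inE; apply.
Qed.

(** The group embeds in the finite power of [rT] indexed by [S]. *)
Lemma variety_joint (gT rT : finGroupType) (S : finType) (r : S -> gT -> rT) :
  H rT -> (forall s, {morph r s : x y / x * y}) ->
  (forall x y, (forall s, r s x = r s y) -> x = y) -> H gT.
Proof.
move=> HrT rM rinj.
have [D HD [d [dM dr]]] : exists2 D : finGroupType, H D & exists d : gT -> D,
    {morph d : x y / x * y} /\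
    forall x y, d x = d y -> forall s, s \in enum S -> r s x = r s y.
  elim: (enum S) => [|s l [D HD [d [dM dr]]]].
    by exists rT => //; exists (fun=> 1); split=> // x y; rewrite mulg1.
  exists (rT * D)%type; first exact: variety_prod.
  exists (fun x => (r s x, d x)); split=> [x y|x y [rxy dxy] t].
    by rewrite rM dM.
  by rewrite inE => /predU1P[->//|]; exact: dr.
apply: (variety_inj _ dM) => // x y dxy; apply: rinj => s.
by apply: dr dxy _ _; rewrite mem_enum.
Qed.

End GroupVariety.

Local Open Scope classical_set_scope.

(** * Membership in the variety of monoids with subgroups in H *)

Lemma subgroup_fingroup (M : monoidType) (A : set M) :
  finite_set A -> is_subgroup A ->
  exists (gT : finGroupType) (f : gT -> M),
    [/\ injective f, {morph f : x y / x * y} & range f = A].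
Proof.
move=> finA [AM [e Ae eP]].
pose T := fset_set A.
have TA (x : T) : A (val x) by move: (valP x); rewrite in_fset_set// => /set_mem.
have toT x : A x -> {t : T | val t = x}.
  move=> Ax; have xT : x \in T by rewrite in_fset_set//; exact: mem_set.
  by exists [` xT]%fset.
have inv_ex (x : T) : {y : T | val y * val x = e}.
  apply: cid; have [_ _ [y Ay [_ yx]]] := eP _ (TA x).
  by have [t tE] := toT _ Ay; exists t; rewrite tE.
pose mul (x y : T) : T := sval (toT _ (AM _ _ (TA x) (TA y))).
pose one : T := sval (toT _ Ae).
pose inv (x : T) : T := sval (inv_ex x).
have mulE x y : val (mul x y) = val x * val y by rewrite /mul; case: (toT _ _).
have oneE : val one = e by rewrite /one; case: (toT _ _).
have invE x : val (inv x) * val x = e by rewrite /inv; case: (inv_ex _).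
have mA : associative mul by move=> x y z; apply: val_inj; rewrite !mulE mulgA.
have m1 : left_id one mul.
  by move=> x; apply: val_inj; rewrite mulE oneE; have [] := eP _ (TA x).
have mV : left_inverse one inv mul.
  by move=> x; apply: val_inj; rewrite mulE invE oneE.
pose gT : finGroupType := HB.pack (fset_sub_type T)
  (Finite_isGroup.Build (fset_sub_type T) mA m1 mV).
exists gT, (fun x => val (x : T)); split=> [x y|x y|].
- exact: val_inj.
- by rewrite -mulE.
- apply/seteqP; split=> [_ [x _ <-]|x Ax]; first exact: TA.
  by have [t tE] := toT _ Ax; exists t.
Qed.

Section Bar.
Variables (H : finGroupType -> Prop) (VH : group_variety H).

Lemma range_is_subgroup (gT : groupType) (M : monoidType) (f : gT -> M) :
  {morph f : x y / x * y} -> is_subgroup (range f).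
Proof.
move=> fM; split=> [_ _ [x _ <-] [y _ <-]|]; first by exists (x * y).
exists (f 1); first by exists 1.
move=> _ [x _ <-]; rewrite -!fM mul1g mulg1; split=> //.
by exists (f x^-1); [exists x^-1|rewrite -!fM mulgV mulVg].
Qed.

(** [bar] speaks of subsets of a monoid; this lemma and the next one translate
    it into a statement about embedded finite groups. *)
Lemma bar_embed (M : monoidType) (gT : finGroupType) (f : gT -> M) :
  bar H M -> injective f -> {morph f : x y / x * y} -> H gT.
Proof.
move=> [_ barM] injf fM.
have [rT HrT [g [injg gM rg]]] := barM _ (range_is_subgroup fM).
have /choice[h hE] x : exists y, g y = f x.
  have : range f (f x) by exists x.
  by rewrite -rg => -[y _ <-]; exists y.
apply: (@variety_inj _ VH _ _ h) HrT => [x y hxy|x y].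
  by apply: injf; rewrite -!hE hxy.
by apply: injg; rewrite gM !hE fM.
Qed.

Lemma embed_bar (M : monoidType) :
  finite_set [set: M] ->
  (forall (gT : finGroupType) (f : gT -> M), injective f ->
     {morph f : x y / x * y} -> H gT) ->
  bar H M.
Proof.
move=> finM HM; split=> // A /subgroup_fingroup[|gT [f [injf fM rf]]].
  exact: sub_finite_set finM.
by exists gT; [exact: HM injf fM|exists f].
Qed.

Hypothesis HE : extension_closed H.

(** A group in [W] is an extension of its image in [M] by a group on which [p]
    is constant. *)
Lemma bar_ext (W M : monoidType) (p : W -> M) :
  bar H M -> {morph p : x y / x * y} -> finite_set [set: W] ->
  (forall (gT : finGroupType) (f : gT -> W), injective f ->
     {morph f : x y / x * y} -> (forall x y, p (f x) = p (f y)) -> H gT) ->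
  bar H W.
Proof.
move=> barM pM finW HW; apply: embed_bar => // gT f injf fM.
have pfM : {morph p \o f : x y / x * y} by move=> x y /=; rewrite fM pM.
have [rT HrT [g [injg gM rg]]] := barM.2 _ (range_is_subgroup pfM).
have /choice[h hE] x : exists y, g y = (p \o f) x.
  have : range (p \o f) ((p \o f) x) by exists x.
  by rewrite -rg => -[y _ <-]; exists y.
have hM : {morph h : x y / x * y}.
  by move=> x y; apply: injg; rewrite gM !hE pfM.
apply: (variety_ext VH HE hM HrT) => K hK.
apply: (HW _ (fun x : subg_of K => f (sgval x))) => [x y /injf|x y|x y].
- exact: val_inj.
- by rewrite -fM.
- by have := hE (sgval x); rewrite /= => <-; rewrite hK ?subgP// -(hK (sgval y)) ?subgP// hE.
Qed.

End Bar.

(** * Wreath products and clocks *)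

Record right_action (M : monoidType) (S : Type) := RightAction {
  ract :> S -> M -> S;
  ract1 : forall s, ract s 1 = s;
  ractM : forall s x y, ract s (x * y) = ract (ract s x) y
}.

(** The second component acts on the states on the right; the first one is the
    output produced from each state. *)
Definition wreath (A : finGroupType) (M : monoidType) (S : finType)
  (a : right_action M S) : Type := ({ffun S -> A} * M)%type.

Section Wreath.
Variables (A : finGroupType) (M : monoidType) (S : finType) (a : right_action M S).
Local Notation W := (wreath A a).

HB.instance Definition _ := Choice.copy W ({ffun S -> A} * M)%type.

Definition wreath_mul (u v : W) : W :=
  ([ffun s => u.1 s * v.1 (a s u.2)], u.2 * v.2).
Definition wreath_one : W := ([ffun=> 1], 1).

Lemma wreath_mulA : associative wreath_mul.
Proof.
move=> u v w; rewrite /wreath_mul mulgA; congr (_, _).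
by apply/ffunP => s; rewrite !ffunE /= ractM mulgA.
Qed.

Lemma wreath_mul1 : left_id wreath_one wreath_mul.
Proof.
move=> [f m]; rewrite /wreath_mul mul1g; congr (_, _).
by apply/ffunP => s; rewrite !ffunE /= ract1 mul1g.
Qed.

Lemma wreath_1mul : right_id wreath_one wreath_mul.
Proof.
move=> [f m]; rewrite /wreath_mul mulg1; congr (_, _).
by apply/ffunP => s; rewrite !ffunE /= mulg1.
Qed.

HB.instance Definition _ :=
  isMonoid.Build W wreath_mulA wreath_mul1 wreath_1mul.

Variables (H : finGroupType -> Prop) (VH : group_variety H).
Hypotheses (HE : extension_closed H) (HA : H A) (barM : bar H M).

(** A group of pairs whose second component is a fixed idempotent [c] is
    determined by its outputs at the states fixed by [c], and there the outputs
    multiply as in a power of [A]. *)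
Lemma wreath_bar : bar H W.
Proof.
have snM : {morph (snd : W -> M) : x y / x * y} by [].
apply: (bar_ext VH HE barM snM).
  rewrite -(setXTT); apply: finite_setX; last exact: barM.1.
  exact: finite_finset.
move=> gT f injf fM snf.
have f2 x : (f x).2 = (f 1).2 by exact: snf.
have fE x s : (f x).1 s = (f 1).1 s * (f x).1 (a s (f 1).2).
  by rewrite -{1}[x]mul1g fM /= ffunE.
apply: (@variety_joint _ VH gT A S (fun s x => (f x).1 (a s (f 1).2))) => //.
  have cc : (f 1).2 * (f 1).2 = (f 1).2 :> M by rewrite -{3}[1]mulg1 fM.
  by move=> s x y /=; rewrite fM /= ffunE f2 -ractM cc.
move=> x y xy; apply: injf.
rewrite [f x]surjective_pairing [f y]surjective_pairing !f2; congr (_, _).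
by apply/ffunP => s; rewrite fE xy -fE.
Qed.

End Wreath.

(** Transformations of a clock with values at most [R]: [(true, t)] sets the
    clock to [t], and [(false, t)] advances it by [t], stopping at [R]. *)
Definition timer (R : nat) : Type := (bool * 'I_R.+1)%type.

Section Timer.
Variable R : nat.
Local Notation U := (timer R).
HB.instance Definition _ := Choice.copy U (bool * 'I_R.+1)%type.

Definition tick (t k : nat) : 'I_R.+1 := inord (minn (t + k) R).

Lemma tickE t k : tick t k = minn (t + k) R :> nat.
Proof. by rewrite inordK // ltnS geq_minr. Qed.

Definition timer_mul (u v : U) : U :=
  if v.1 then v else (u.1, tick u.2 v.2).
Definition timer_one : U := (false, ord0).

Lemma timer_mulA : associative timer_mul.
Proof.
move=> [b i] [c j] [[] k] //; case: c => //; congr (_, _); apply: val_inj.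
rewrite /= !tickE; lia.
Qed.

Lemma timer_mul1 : left_id timer_one timer_mul.
Proof.
move=> [[] i] //; congr (_, _); apply: val_inj; rewrite /= tickE.
by have := ltn_ord i; rewrite ltnS => /minn_idPl.
Qed.

Lemma timer_1mul : right_id timer_one timer_mul.
Proof.
move=> [b i]; congr (_, _); apply: val_inj; rewrite /= tickE addn0.
by have := ltn_ord i; rewrite ltnS => /minn_idPl.
Qed.

HB.instance Definition _ :=
  isMonoid.Build U timer_mulA timer_mul1 timer_1mul.

Lemma timer_reset (u v : U) : v.1 -> u * v = v.
Proof. by move=> v1; rewrite -[LHS]/(timer_mul u v) /timer_mul v1. Qed.

Lemma timer_tick (u v : U) : v.1 = false -> u * v = (u.1, tick u.2 v.2).
Proof. by move=> v1; rewrite -[LHS]/(timer_mul u v) /timer_mul v1. Qed.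

(** All subgroups of the timer monoid are trivial: an advance by [t] that is
    idempotent has [t = 0] or [t = R]. *)
Lemma timer_aperiodic (gT : finGroupType) (f : gT -> U) :
  {morph f : x y / x * y} -> forall x, f x = f 1.
Proof.
move=> fM x; case f1: (f 1).1; first by rewrite -[x]mulg1 fM timer_reset.
have nores y : (f y).1 = false.
  apply: contraFF f1 => fy; by rewrite -(mulVg y) fM timer_reset.
have tk y z : (f (y * z)).2 = minn ((f y).2 + (f z).2) R :> nat.
  by rewrite fM timer_tick // tickE.
rewrite [f x]surjective_pairing [f 1]surjective_pairing !nores; congr (_, _).
have h0 := tk 1 1; have h1 := tk x 1; have h2 := tk x x^-1.
rewrite mulg1 in h0; rewrite mulg1 in h1; rewrite mulgV in h2; apply: val_inj => /=.
move: (ltn_ord (f x).2) (ltn_ord (f 1).2) h0 h1 h2.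
move: (nat_of_ord (f x).2) (nat_of_ord (f 1).2) (nat_of_ord (f x^-1).2).
by move=> i j k; lia.
Qed.

Lemma prod_timer_bar (H : finGroupType -> Prop) (M : monoidType) :
  group_variety H -> extension_closed H -> (exists A, H A) ->
  bar H M -> bar H (M * U)%type.
Proof.
move=> VH HE [A HA] barM.
have fsM : {morph (fst : M * U -> M) : x y / x * y} by [].
apply: (bar_ext VH HE barM fsM).
  rewrite -(setXTT); apply: finite_setX; first exact: barM.1.
  exact: finite_finset.
move=> gT f injf fM fstf.
have sfM : {morph (fun x => (f x).2 : U) : x y / x * y} by move=> x y; rewrite fM.
apply: (@variety_inj _ VH gT A (fun=> 1)) => // [x y _|x y]; last by rewrite mulg1.
apply: injf; rewrite [f x]surjective_pairing [f y]surjective_pairing.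
have /= fx := timer_aperiodic sfM x; have /= fy := timer_aperiodic sfM y.
by congr (_, _); [exact: fstf|rewrite fx fy].
Qed.

(** The value [t] of the clock is identified with the reset to [t]. *)
Definition timer_act (t : 'I_R.+1) (u : U) : 'I_R.+1 := (((true, t) : U) * u).2.

Lemma timer_act1 t : timer_act t 1 = t.
Proof. by rewrite /timer_act mulg1. Qed.

Lemma timer_actM t u v : timer_act t (u * v) = timer_act (timer_act t u) v.
Proof.
rewrite /timer_act mulgA; congr (_ * v).2.
case u1: u.1; last by rewrite timer_tick.
by rewrite timer_reset // [u in LHS]surjective_pairing u1.
Qed.

End Timer.

(** * Projective limits seen through their coordinates *)

Section ProLimit.
Variables (V : monoidType -> Prop) (S : proj_system V) (M : topMonoidType).
Local Notation P := (prod_topology (fun i : idx S => discrete_topology (obj i))).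

(** A projective limit described by its coordinates [f i], without the product
    space: the coordinates are compatible, separate points, realize every
    thread, and their fibres form a basis of neighbourhoods (directedness of the
    index set makes intersections of fibres superfluous). *)
Definition limit_cone (f : forall i : idx S, M -> obj i) : Prop :=
  [/\ forall i, monoid_morphism (f i),
      forall i j x, idx_le i j -> conn i (f j x) = f i x,
      forall x y, (forall i, f i x = f i y) -> x = y,
      forall a : (forall i, obj i), (forall i j, idx_le i j -> conn i (a j) = a i) ->
        exists x, forall i, f i x = a i &
      forall x (U : set M), nbhs x U <-> exists i, forall y, f i y = f i x -> U y].

Lemma open_coord i (v : obj i) : open [set p : P | p i = v :> obj i].
Proof.
have od : open ([set v] : set (discrete_topology (obj i))).
  by rewrite openE => _ ->; rewrite /interior nbhs_principalE; exact/principal_filterP.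
rewrite openE => p pv; rewrite /interior.
have /cvg_sup/(_ i) : nbhs p --> p by exact: cvg_id.
apply; rewrite nbhsE; exists [set q : P | p i = q i]; last by move=> q /= <-.
split=> //; exists [set v] => //; apply/seteqP.
by split=> q /=; rewrite pv.
Qed.

(** For the neighbourhoods, the point is that the images of the fibres of
    coordinates generate a filter which converges in the product topology. *)
Lemma proj_limitP : is_proj_limit S M <-> exists f, limit_cone f.
Proof.
split.
- move=> [f [fM finj rf fopen]].
  have thr x : threads S (f x) by rewrite -rf; exists x.
  exists (fun i x => f x i); split.
  + exact: fM.
  + by move=> i j x ij; exact: thr.
  + by move=> x y xy; apply: finj; apply: functional_extensionality_dep.
  + move=> a aP; have : threads S a by [].
    by rewrite -rf => -[x _ xa]; exists x => i; rewrite xa.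
  + move=> x U; split; last first.
      move=> [i iU]; rewrite nbhsE; exists [set y | f y i = f x i :> obj i] => //.
      split=> //; apply/fopen; exists [set p : P | p i = f x i :> obj i] => //.
      exact: open_coord.
    rewrite nbhsE => -[B [/fopen[W oW <-] Wx] BU].
    pose Phi : set_system P := fun Q => exists i, forall y, f y i = f x i -> Q (f y).
    have PhiF : Filter Phi.
      split.
      * by have [i] := idx_inhabited S; exists i.
      * move=> Q Q' [i iQ] [j jQ']; have [k [ik jk]] := idx_directed i j.
        exists k => y yx; split.
          by apply: iQ; rewrite -!(thr _ _ _ ik) yx.
        by apply: jQ'; rewrite -!(thr _ _ _ jk) yx.
      * by move=> Q Q' QQ' [i iQ]; exists i => y /iQ /QQ'.
    have Phix : Phi --> f x.
      apply/cvg_sup => i Q.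
      rewrite nbhsE => -[_ [[C oC <-] Cx] CQ].
      by exists i => y yx; apply: CQ; rewrite /= /proj yx.
    have [i iW] : Phi W by apply: Phix; exact: open_nbhs_nbhs.
    by exists i => y /iW /BU.
- move=> [f [fM fc finj fsurj fnbhs]].
  exists (fun x i => f i x); split=> //.
  + by move=> x y xy; apply: finj => i; rewrite -[LHS]/((fun i => f i x) i) xy.
  + apply/seteqP; split=> [_ [x _ <-] i j ij|a aP]; first exact: fc.
    have [x xa] := fsurj a aP.
    by exists x => //; apply: functional_extensionality_dep.
  + move=> U; split=> [oU|[W oW <-]].
      exists (\bigcup_(u in [set u : M * idx S |
          forall y, f u.2 y = f u.2 u.1 -> U y])
          [set p : P | p u.2 = f u.2 u.1 :> obj u.2]).
        by apply: bigcup_open => u _; exact: open_coord.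
      apply/seteqP; split=> [y [[x i] /= h yx]|x Ux]; first exact: h.
      have /fnbhs[i iU] : nbhs x U by exact: open_nbhs_nbhs.
      by exists (x, i).
    have fcont : continuous (fun x => (fun i => f i x) : P).
      move=> x; apply/cvg_sup => i Q; rewrite nbhsE => -[_ [[C oC <-] Cx] CQ].
      by apply/fnbhs; exists i => y yx; apply: CQ; rewrite /= /proj yx.
    by move/continuousP: fcont; exact.
Qed.

End ProLimit.

(** * Locally constant functions on free pro-V monoids *)

(** Finite discrete monoids are the test objects for the universal property. *)
Definition discrete_monoid (M : monoidType) : Type := discrete_topology M.

Section DiscreteMonoid.
Variable M : monoidType.
Local Notation D := (discrete_monoid M).

HB.instance Definition _ := Topological.copy D (discrete_topology M).
HB.instance Definition _ := isMonoid.Build D (@mulgA M) (@mul1g M) (@mulg1 M).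

Lemma discrete_nbhs (x : D) (U : set D) : nbhs x U <-> U x.
Proof.
rewrite -[nbhs x]/(nbhs (x : discrete_topology M)) nbhs_principalE.
exact: principal_filterP.
Qed.

Lemma discrete_mul_continuous : continuous (fun z : D * D => z.1 * z.2).
Proof.
move=> [x y] U /discrete_nbhs Uxy.
exists ([set x], [set y]); first by split; exact/discrete_nbhs.
by move=> [a b] /= [-> ->].
Qed.

HB.instance Definition _ := isTopMonoid.Build D discrete_mul_continuous.

Lemma discrete_pro (V : monoidType -> Prop) : V M -> pro V D.
Proof.
move=> VM.
have idM : monoid_morphism (fun x : M => x) by split.
pose S := @ProjSystem V unit (fun _ _ => True) (fun=> I) (fun _ _ _ _ _ => I)
  (inhabits tt) (fun i j => ex_intro _ tt (conj I I)) (fun=> M) (fun=> VM)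
  (fun _ _ x => x) (fun _ _ _ => idM) (fun _ _ => erefl)
  (fun _ _ _ _ _ _ => erefl).
exists S; apply/proj_limitP; exists (fun (i : idx S) (x : D) => x : obj i).
split=> //.
- by move=> x y /(_ tt).
- by move=> a aP; exists (a tt) => -[].
- move=> x U; split=> [/discrete_nbhs Ux|[i Ui]]; first by exists tt => y ->.
  by apply/discrete_nbhs; exact: Ui.
Qed.

End DiscreteMonoid.

Section Levels.
Variables (V : monoidType -> Prop) (S : proj_system V) (F : topMonoidType).
Variables (f : forall i : idx S, F -> obj i).
Hypothesis cone : limit_cone f.

Definition sees (T : Type) (i : idx S) (g : F -> T) : Prop :=
  forall x y, f i x = f i y -> g x = g y.

Definition locally_constant (T : Type) (g : F -> T) : Prop := exists i, sees i g.

Lemma level_morph i : monoid_morphism (f i).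
Proof. by case: cone. Qed.

Lemma seesW T (g : F -> T) i j : idx_le i j -> sees i g -> sees j g.
Proof.
have [_ fc _ _ _] := cone.
by move=> ij gi x y xy; apply: gi; rewrite -!(fc _ _ _ ij) xy.
Qed.

Lemma lc_common T T' (g : F -> T) (g' : F -> T') :
  locally_constant g -> locally_constant g' -> exists i, sees i g /\ sees i g'.
Proof.
move=> [i gi] [j gj]; have [k [ik jk]] := idx_directed i j.
by exists k; split; [exact: seesW ik gi|exact: seesW jk gj].
Qed.

(** Compactness makes the level uniform. *)
Lemma lc_local T (g : F -> T) : compact [set: F] ->
  (forall x, exists i, forall y, f i y = f i x -> g y = g x) ->
  locally_constant g.
Proof.
move=> /compact_near_coveringP Fcpt gloc; have [_ fc _ _ fnbhs] := cone.
pose Phi : set_system (idx S) := fun Q => exists i, forall j, idx_le i j -> Q j.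
have PhiF : Filter Phi.
  split.
  - by have [i] := idx_inhabited S; exists i.
  - move=> Q Q' [i iQ] [j jQ']; have [k [ik jk]] := idx_directed i j.
    exists k => l kl; split; [apply: iQ|apply: jQ'].
      exact: idx_le_trans kl.
    exact: idx_le_trans kl.
  - by move=> Q Q' QQ' [i iQ]; exists i => j /iQ /QQ'.
pose P j x := forall y, f j y = f j x -> g y = g x.
have [|i iP] := Fcpt _ Phi P PhiF.
  move=> x _; have [i ix] := gloc x.
  exists ([set y | f i y = f i x], [set j | idx_le i j]).
    by split; [apply/fnbhs; exists i|exists i].
  move=> [y j] /= [yx ij] z zy.
  rewrite (ix _ yx) (ix z)// -yx -(fc _ _ _ ij) -(fc _ _ y ij).
  by rewrite zy.
by exists i => x y xy; apply: (iP i (idx_le_refl i) y).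
Qed.

Lemma continuous_lc (M : monoidType) (g : F -> discrete_monoid M) :
  compact [set: F] -> continuous g -> locally_constant g.
Proof.
have [_ _ _ _ fnbhs] := cone.
move=> Fcpt gc; apply: lc_local => // x.
apply/(fnbhs x [set y | g y = g x]).
by apply: (gc x [set y | y = g x]); exact/discrete_nbhs.
Qed.

Lemma lc_continuous (M : monoidType) (g : F -> discrete_monoid M) :
  locally_constant g -> continuous g.
Proof.
have [_ _ _ _ fnbhs] := cone.
move=> [i gi] x U /discrete_nbhs Ux.
by apply/fnbhs; exists i => y /gi /= ->.
Qed.

End Levels.
Arguments sees {V S F} f {T} i g.
Arguments locally_constant {V S F} f {T} g.

Section Free.
Variables (H : finGroupType -> Prop) (VH : group_variety H).
Variables (X : Type) (F : topMonoidType) (iota : X -> F).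
Hypotheses (Ffree : free_pro (bar H) iota) (Fcpt : compact [set: F]).
Variables (S : proj_system (bar H)) (f : forall i : idx S, F -> obj i).
Hypothesis cone : limit_cone f.

Lemma free_finite (M : monoidType) (tau : X -> M) : bar H M ->
  exists g : F -> M,
    [/\ monoid_morphism g, locally_constant f g & forall x, g (iota x) = tau x].
Proof.
move=> barM; have [_ /(_ (discrete_monoid M) (discrete_pro barM) tau)] := Ffree.
move=> [g [gtau _]]; exists g; split=> //; first exact: (cmorphP g).
by apply: (continuous_lc cone Fcpt); exact: cmorph_continuous.
Qed.

Lemma free_finite_unique (M : monoidType) (g h : F -> M) : bar H M ->
  monoid_morphism g -> locally_constant f g ->
  monoid_morphism h -> locally_constant f h ->
  (forall x, g (iota x) = h (iota x)) -> forall w, g w = h w.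
Proof.
move=> barM gM glc hM hlc gh w.
pose cg := @CMorph F (discrete_monoid M) g gM (lc_continuous cone glc).
pose ch := @CMorph F (discrete_monoid M) h hM (lc_continuous cone hlc).
have [_ /(_ (discrete_monoid M) (discrete_pro barM) (h \o iota))] := Ffree.
move=> [k [_ kuniq]].
have kg : k = cg by apply: kuniq.
have kh : k = ch by apply: kuniq.
by rewrite -[g w]/(cg w) -[h w]/(ch w) -kg kh.
Qed.

Definition word (s : seq X) : F := foldl (fun w x => w * iota x) 1 s.

Lemma word_rcons s x : word (rcons s x) = word s * iota x.
Proof. by rewrite /word -cats1 foldl_cat. Qed.

Lemma word_cat s t : word (s ++ t) = word s * word t.
Proof.
elim/last_ind: t => [|t x IH]; first by rewrite cats0 /word mulg1.
by rewrite -rcons_cat !word_rcons IH mulgA.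
Qed.

(** The submonoid of [obj i] generated by the letters is in [bar H], so [f i]
    corestricts to it by the universal property. *)
Lemma word_dense i (w : F) : exists s, f i w = f i (word s).
Proof.
have [f1 fM] := level_morph cone i.
pose A : set (obj i) := [set f i (word s) | s in [set: seq X]].
have A1 : A 1 by exists [::].
have AM x y : A x -> A y -> A (x * y).
  by move=> [s _ <-] [t _ <-]; exists (s ++ t) => //; rewrite word_cat fM.
pose mul (x y : set_type A) : set_type A := SigSub (mem_set (AM _ _ (set_valP x) (set_valP y))).
pose one : set_type A := SigSub (mem_set A1).
have mA : associative mul by move=> x y z; apply: val_inj; rewrite /= mulgA.
have m1 : left_id one mul by move=> x; apply: val_inj; rewrite /= mul1g.
have m2 : right_id one mul by move=> x; apply: val_inj; rewrite /= mulg1.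
pose M0 : monoidType := HB.pack (set_type A) (isMonoid.Build (set_type A) mA m1 m2).
pose v (x : M0) : obj i := val (x : set_type A).
have vM : {morph v : x y / x * y} by [].
have barM0 : bar H M0.
  have [finM barM] := objP i; apply: embed_bar => //.
    have -> : [set: M0] = v @^-1` [set: obj i] by [].
    by apply: finite_preimage finM => x y _ _ /val_inj.
  move=> gT g injg gM; apply: (@bar_embed _ VH (obj i) gT (v \o g) (objP i)).
    by move=> x y /val_inj /injg.
  by move=> x y /=; rewrite gM vM.
have At x : A (f i (iota x)).
  by exists [:: x] => //; rewrite /word /= mul1g.
have [g [[g1 gM] glc gt]] := free_finite (fun x => SigSub (mem_set (At x)) : M0) barM0.
have /(_ w) <- : forall w, (v \o g) w = f i w.
  apply: free_finite_unique => //.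
  - exact: objP.
  - by split=> [|x y] /=; rewrite ?g1 ?gM.
  - by have [j gj] := glc; exists j => x y /gj /= ->.
  - by exists i.
  - by move=> x /=; rewrite gt.
by have [s _ sE] := set_valP (g w : set_type A); exists s.
Qed.

Lemma word_ind (P : F -> Prop) :
  locally_constant f P -> P 1 -> (forall w x, P w -> P (w * iota x)) ->
  forall w, P w.
Proof.
move=> [i Pi] P1 PM w; have [s /Pi ->] := word_dense i w.
by elim/last_ind: s => // s x IH; rewrite word_rcons; exact: PM.
Qed.

End Free.

(** * The minimal ideal, and automata over the free monoid *)

Lemma finite_repeat (T : Type) (u : nat -> T) : finite_set [set: T] ->
  exists k d, (0 < d)%N /\ u (k + d)%N = u k.
Proof.
move=> finT; apply: contrapT => norep.
have injle k l : (k <= l)%N -> u k = u l -> k = l.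
  rewrite leq_eqVlt => /predU1P[//|kl] ukl; exfalso; apply: norep.
  by exists k, (l - k)%N; rewrite subn_gt0 subnKC// ltnW.
have injn : injective u.
  by move=> k l ukl; have [/injle->//|/ltnW/injle->] := leqP k l.
apply: infinite_nat; rewrite -[setT]/(u @^-1` [set: T]).
by apply: finite_preimage finT => k l _ _ /injn.
Qed.

Lemma finite_enum (T : choiceType) : finite_set [set: T] ->
  exists (E : finType) (enc : T -> E) (dec : E -> T), cancel enc dec /\ cancel dec enc.
Proof.
move=> finT; have inT (x : T) : x \in fset_set [set: T].
  by rewrite in_fset_set//; exact: mem_set.
exists (fset_sub_type (fset_set [set: T])), (fun x => [` inT x]%fset).
by exists (fun t => val t); split=> // t; exact: val_inj.
Qed.

(** Finite monoids are Dedekind-finite: [r] has a left inverse, so a repetition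
    among its powers can be cancelled. *)
Lemma finite_monoid_inverse (M : monoidType) (c p r : M) :
  finite_set [set: M] -> c * r = r -> c * p = p -> p * c = p ->
  p * r = c -> r * p = c.
Proof.
move=> finM cr cp pc pr; pose u k := iter k (fun x => r * x) c.
have cc : c * c = c by rewrite -{2}pr mulgA cp.
have cu k : c * u k = u k by case: k => [//|k]; rewrite /= mulgA cr.
have pu k : p * u k.+1 = u k by rewrite /= mulgA pr cu.
have [k [d [d0 ukd]]] := finite_repeat u finM; case: d d0 ukd => // d _ ukd.
have ud : u d.+1 = c.
  elim: k ukd => [//|k IH] ukd; apply: IH.
  by rewrite -[LHS]pu -[RHS]pu -addSn ukd.
have <- : u d = p by rewrite -[LHS]pu ud pc.
by rewrite -[RHS]ud.
Qed.

Section MinimalIdeal.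
Variables (F : monoidType) (I : set F) (e : F).
Hypotheses (minI : minimal_ideal I) (Ie : I e).

Lemma minimal_ideal_div z : exists a b, e = a * z * b.
Proof.
have [[I0 idI] minJ] := minI.
pose J : set F := I `&` [set a * z * b | a in [set: F] & b in [set: F]].
have JI : J `<=` I by move=> x [].
have idJ : ideal J.
  split=> [|a x b [Ix [c _ [d _ xE]]]].
    exists (e * z); split; first by rewrite -[e]mul1g; exact: idI.
    by exists e => //; exists 1 => //; rewrite mulg1.
  split; first exact: idI.
  by exists (a * c) => //; exists (d * b) => //; rewrite -xE !mulgA.
have := Ie; rewrite -(minJ J idJ JI) => -[_ [a _ [b _ <-]]].
by exists a, b.
Qed.

Variables (V : monoidType -> Prop) (S : proj_system V).
Variables (f : forall i : idx S, F -> obj i).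
Hypotheses (finV : forall M, V M -> finite_set [set: M]).
Hypotheses (fM : forall i, monoid_morphism (f i)).
Hypotheses (finj : forall x y, (forall i, f i x = f i y) -> x = y).
Hypothesis ee : e * e = e.

(** The corner at an idempotent of the minimal ideal is a group: minimality gives
    a factorization of [e] through any element, hence one-sided inverses, and
    these are two-sided because they are so in every finite quotient. *)
Lemma minimal_corner_inverse w :
  exists g, [/\ e * g = g, g * e = g, e * w * e * g = e & g * (e * w * e) = e].
Proof.
have swap p r : e * r = r -> e * p = p -> p * e = p -> p * r = e -> r * p = e.
  move=> er ep pe pr; apply: finj => i; rewrite (fM i).2.
  apply: finite_monoid_inverse; rewrite -?(fM i).2; try by congr f.
  exact: finV (objP i).
pose z := e * w * e.
have ez : e * z = z by rewrite /z !mulgA ee.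
have ze : z * e = z by rewrite /z -mulgA ee.
have [a [b ezb]] := minimal_ideal_div z.
pose p := e * a * e; pose q := e * b * e.
have ep : e * p = p by rewrite /p !mulgA ee.
have pe : p * e = p by rewrite /p -mulgA ee.
have eq : e * q = q by rewrite /q !mulgA ee.
have qe : q * e = q by rewrite /q -mulgA ee.
have pzq : p * z * q = e.
  have -> : p * z * q = e * (a * (e * z * e) * b) * e by rewrite /p /q !mulgA.
  by rewrite ez ze -ezb !ee.
exists (q * p); split.
- by rewrite mulgA eq.
- by rewrite -mulgA pe.
- rewrite -/z mulgA; apply: swap => //; first by rewrite mulgA ez.
  by rewrite mulgA.
- rewrite -/z -mulgA; apply: swap => //; first by rewrite mulgA ep.
  by rewrite -mulgA ze.
Qed.

End MinimalIdeal.

Section Cocycle.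
Variables (H : finGroupType -> Prop) (VH : group_variety H).
Hypothesis HE : extension_closed H.
Variables (X : Type) (F : topMonoidType) (iota : X -> F).
Hypotheses (Ffree : free_pro (bar H) iota) (Fcpt : compact [set: F]).
Variables (S : proj_system (bar H)) (f : forall i : idx S, F -> obj i).
Hypothesis cone : limit_cone f.

(** An automaton over the alphabet [X] with states [Om] and outputs in [A],
    extended to all of [F]: [c s w] is the output of [w] read from [s]. *)
Record cocycle (A : groupType) (M : monoidType) (h : F -> M) (Om : finType)
    (act : right_action M Om) (a : Om -> X -> A) (c : Om -> F -> A) : Prop := Cocycle {
  cocycle1 : forall s, c s 1 = 1;
  cocycleM : forall s w w', c s (w * w') = c s w * c (act s (h w)) w';
  cocycle_gen : forall s x, c s (iota x) = a s x;
  cocycle_lc : locally_constant f (fun w => [ffun s => c s w])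
}.

Lemma cocycle_lc1 (A : groupType) (M : monoidType) (h : F -> M) (Om : finType)
    (act : right_action M Om) a c s :
  @cocycle A M h Om act a c -> locally_constant f (c s).
Proof.
by case=> _ _ _ [i ci]; exists i => x y /ci /ffunP/(_ s); rewrite !ffunE.
Qed.

(** The cocycle is the first component of the map to the wreath product which
    freeness provides. *)
Lemma cocycle_exists (A : finGroupType) (M : monoidType) (h : F -> M)
    (Om : finType) (act : right_action M Om) (a : Om -> X -> A) :
  H A -> bar H M -> monoid_morphism h -> locally_constant f h ->
  exists c, cocycle h act a c.
Proof.
move=> HA barM hM hlc.
have barW := wreath_bar act VH HE HA barM.
have [g [[g1 gM] glc gt]] := free_finite Ffree Fcpt cone
  (fun x => ([ffun s => a s x], h (iota x)) : wreath A act) barW.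
have gh w : (g w).2 = h w.
  apply: (free_finite_unique Ffree cone barM (g := fun w => (g w).2)) => //.
  - by split=> [|x y] /=; rewrite ?g1 ?gM.
  - by have [i gi] := glc; exists i => x y /gi ->.
  - by move=> x /=; rewrite gt.
exists (fun s w => (g w).1 s); split.
- by move=> s; rewrite g1 ffunE.
- by move=> s w w'; rewrite gM /= ffunE gh.
- by move=> s x; rewrite gt ffunE.
- by have [i gi] := glc; exists i => x y /gi ->.
Qed.

Variables (e : F) (N : groupType) (v : N -> F).
Hypotheses (vM : {morph v : x y / x * y}) (v1 : v 1 = e).

Definition locally_constant_on (T : Type) (g : N -> T) : Prop :=
  exists i, forall n n', f i (v n) = f i (v n') -> g n = g n'.

(** [N] acts on the left of a finite quotient [M], and its orbits, as elements
    of the powerset of [M], are the states; the orbit [s0] of [e] is fixed by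
    [N].  After a representative [rho s] of each orbit is chosen, the output
    [b s x] is the value of [g] at an element of [N] that compares [rho s * x]
    with the representative of its orbit.  The states are taken in the whole
    powerset to avoid a quotient type, so [b] has a default value elsewhere. *)
Lemma cocycle_represents (A : groupType) (g : N -> A) :
  {morph g : x y / x * y} -> locally_constant_on g ->
  exists (M : monoidType) (h : F -> M) (Om : finType) (act : right_action M Om) (s0 : Om)
      (b : Om -> X -> A),
    [/\ bar H M, monoid_morphism h, locally_constant f h,
      forall n, act s0 (h (v n)) = s0 &
      forall c, cocycle h act b c -> forall n, c s0 (v n) = g n].
Proof.
move=> gM [i gi]; pose M := obj i; pose h := f i.
have barM : bar H M by exact: objP.
have [h1 hM] : monoid_morphism h by exact: (level_morph cone).
have [E [enc [dec [encK decK]]]] := finite_enum barM.1.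
pose act_fun (s : {set E}) (m : M) := [set enc (dec t * m) | t in s]%SET.
have act1 s : act_fun s 1 = s.
  by rewrite -[RHS]imset_id; apply: eq_imset => t; rewrite mulg1 decK.
have actM s x y : act_fun s (x * y) = act_fun (act_fun s x) y.
  by rewrite /act_fun -imset_comp; apply: eq_imset => t /=; rewrite encK mulgA.
pose act := RightAction act1 actM.
pose s0 : {set E} := [set t | `[< exists n, dec t = h (v n) >]]%SET.
have stP w t : (t \in act s0 (h w)) <-> exists n, dec t = h (v n * w).
  split=> [/imsetP[u]|[n tE]].
    by rewrite inE => /asboolP[n un] ->; exists n; rewrite encK un hM.
  apply/imsetP; exists (enc (h (v n))); last by rewrite encK -hM -tE decK.
  by rewrite inE; apply/asboolP; exists n; rewrite encK.
pose rho (s : {set E}) : M := if s == s0 then h e else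
   if [pick t in s] is Some t then dec t else 1.
have rhoP w : exists n, rho (act s0 (h w)) = h (v n * w).
  have he : enc (h e) \in s0.
    by rewrite inE; apply/asboolP; exists 1; rewrite encK v1.
  rewrite /rho; case: eqP => [ws0|_].
    by have := he; rewrite -{1}ws0 => /stP; rewrite encK.
  case: pickP => [t /stP//|/(_ (enc (h (v 1 * w))))/negP[]].
  by apply/stP; exists 1; rewrite encK.
have rho0 : rho s0 = h e by rewrite /rho eqxx.
pose step s x n := rho s * h (iota x) = h (v n) * rho (act s (h (iota x))).
pose b s x := if pselect (exists n, step s x n) is left P then g (sval (cid P)) else 1.
have act0 n : act s0 (h (v n)) = s0.
  apply/setP => t; apply/idP/idP => [/stP[n' tE]|].
    by rewrite inE; apply/asboolP; exists (n' * n); rewrite vM.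
  rewrite inE => /asboolP[n' tE]; apply/stP; exists (n' * n^-1).
  by rewrite -vM -mulgA mulVg mulg1.
have ev n : e * v n = v n by rewrite -v1 -vM mul1g.
have ve n : v n * e = v n by rewrite -v1 -vM mulg1.
exists M, h, {set E}, act, s0, b; split=> //; first by exists i.
move=> c cc.
(* The output read from [s0] measures the position of [e w] in its orbit. *)
have cP : forall w, exists n, g n = c s0 w /\ h e * h w = h (v n) * rho (act s0 (h w)).
  apply: (word_ind VH Ffree Fcpt cone).
  - have [j [jc jh]] := lc_common cone (cocycle_lc1 s0 cc)
      (ex_intro _ i (fun x y xy => xy) : locally_constant f h).
    by exists j => x y xy; rewrite (jc _ _ xy) (jh _ _ xy).
  - exists 1; rewrite (cocycle1 cc) v1 h1 mulg1 ract1 rho0 -hM; split.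
      by rewrite -[g 1]mul1g -{1}(mulVg (g 1)) -mulgA -gM mulg1 mulVg.
    by rewrite -{1}v1 -{1}[1]mulg1 vM v1.
  - move=> w x [n [gn hn]].
    have [n1 E1] := rhoP w; have [n2 E2] := rhoP (w * iota x).
    have stepn : exists n', step (act s0 (h w)) x n'.
      exists (n1 * n2^-1); rewrite /step -ractM -hM E2 -hM E1 -hM.
      by rewrite vM !mulgA -[v n1 * _ * v n2]mulgA -vM mulVg v1 ve.
    have bE : b (act s0 (h w)) x = g (sval (cid stepn)).
      rewrite /b; case: pselect => // P; congr (g (sval (cid _))).
      exact: Prop_irrelevance.
    case: (cid stepn) bE => n' /= n'E bE.
    exists (n * n'); split.
      by rewrite (cocycleM cc) (cocycle_gen cc) gM gn bE.
    by rewrite hM mulgA hn -mulgA n'E mulgA vM [h (v n * _)]hM actM.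
move=> n; have [n' [<- hn']] := cP (v n); apply: gi.
rewrite act0 rho0 -!hM ev ve in hn'; exact/esym.
Qed.

End Cocycle.

(** * Embedding problems for the kernel *)

Section Embedding.
Variables (H : finGroupType -> Prop) (VH : group_variety H).
Hypothesis HE : extension_closed H.
Variables (X : eqType) (F : topMonoidType) (iota : X -> F).
Hypotheses (Ffree : free_pro (bar H) iota) (Fcpt : compact [set: F]).
Variables (S : proj_system (bar H)) (f : forall i : idx S, F -> obj i).
Hypothesis cone : limit_cone f.
Variables (e : F) (K : groupType) (pi : F -> K) (N : groupType) (v : N -> F).
Hypotheses (vM : {morph v : x y / x * y}) (v1 : v 1 = e).
Local Notation locally_constant_on := (locally_constant_on f v).
Local Notation cocycle := (cocycle iota f).

Lemma locally_constant_on_cocycle (A : groupType) (M : monoidType) (h : F -> M) (Om : finType)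
    (act : right_action M Om) (a : Om -> X -> A) (c : Om -> F -> A) s :
  cocycle h act a c -> locally_constant_on (fun n => c s (v n)).
Proof. by move=> /cocycle_lc1-/(_ s)[i ci]; exists i => n n' /ci. Qed.

Lemma cocycle_morph (A : groupType) (M : monoidType) (h : F -> M) (Om : finType)
    (act : right_action M Om) (a : Om -> X -> A) (c : Om -> F -> A) s :
  cocycle h act a c -> (forall n, act s (h (v n)) = s) ->
  {morph (fun n => c s (v n)) : x y / x * y}.
Proof. by move=> cc fix_s n n'; rewrite vM (cocycleM cc) fix_s. Qed.

(** Lift the outputs of the automaton of [be] letter by letter. *)
Lemma projective (A : finGroupType) (B : finGroupType) (al : A -> B) (be : N -> B) :
  H A -> {morph al : x y / x * y} -> (forall b, exists a, al a = b) ->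
  {morph be : x y / x * y} -> locally_constant_on be ->
  exists ga : N -> A,
    [/\ {morph ga : x y / x * y}, locally_constant_on ga & forall n, al (ga n) = be n].
Proof.
move=> HA alM alonto beM belc.
have [M [h [Om [act [s0 [b [barM hM hlc fixs0 rep]]]]]]] :=
  cocycle_represents VH Ffree Fcpt cone vM v1 beM belc.
have [lift liftP] := choice alonto.
have [c cc] := cocycle_exists VH HE Ffree Fcpt cone act (fun s x => lift (b s x)) HA barM hM hlc.
exists (fun n => c s0 (v n)); split.
- exact: cocycle_morph cc fixs0.
- exact: locally_constant_on_cocycle cc.
- apply: (rep (fun s w => al (c s w))); split.
  + by move=> s; rewrite (cocycle1 cc); apply: (mulgI (al 1)); rewrite -alM !mulg1.
  + by move=> s w w'; rewrite (cocycleM cc) alM.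
  + by move=> s x; rewrite (cocycle_gen cc) liftP.
  + have [i ci] := cocycle_lc cc; exists i => x y /ci /ffunP xy.
    by apply/ffunP => s; have := xy s; rewrite !ffunE => ->.
Qed.

Hypothesis piM : monoid_morphism pi.
Hypothesis vP : forall z, (exists n, v n = z) <-> [/\ e * z = z, z * e = z & pi z = 1].
Hypothesis einv : forall w, exists g,
  [/\ e * g = g, g * e = g, e * w * e * g = e & g * (e * w * e) = e].
Hypothesis ediv : forall z, exists a b, e = a * z * b.

Let vn n : [/\ e * v n = v n, v n * e = v n & pi (v n) = 1].
Proof. by apply/vP; exists n. Qed.

Let pie : pi e = 1.
Proof. by rewrite -v1; have [] := vn 1. Qed.

Let ee : e * e = e.
Proof. by rewrite -{2}v1; have [->] := vn 1. Qed.

Section Holonomy.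
Variables (A : groupType) (M : monoidType) (h : F -> M) (Om : finType)
    (act : right_action M Om) (a : Om -> X -> A) (c : Om -> F -> A) (s0 : Om).
Hypotheses (cc : cocycle h act a c) (hM : monoid_morphism h).
Hypothesis fixs0 : forall n, act s0 (h (v n)) = s0.
Local Notation P := (c s0).
Local Notation T w := (act s0 (h w)).
Local Notation ga n := (c s0 (v n)).

Let gaM : {morph (fun n => ga n) : x y / x * y} := cocycle_morph cc fixs0.

Let P_e : P e = 1.
Proof. by rewrite -v1; apply: (mulgI (ga 1)); rewrite -gaM !mulg1. Qed.

Let T_e : T e = s0.
Proof. by rewrite -v1 fixs0. Qed.

Let TM w w' : T (w * w') = act (T w) (h w').
Proof. by rewrite hM.2 ractM. Qed.

(** The element [q] plays the role of [w / w']: it is [w] followed by the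
    inverse of [e w' e] in the group at [e].  Its output only depends on those of
    [w] and [w'] because both end in the same state. *)
Lemma holonomy_quotient w w' : T w = T w' -> exists q,
  [/\ T q = s0, P q = P w * (P w')^-1, pi q = pi w * (pi w')^-1 & q * e = q].
Proof.
move=> Tww; have [g [eg ge wg gw]] := einv w'.
have wg' : e * (w' * (e * g)) = e by rewrite !mulgA.
have Twg : T (w' * (e * g)) = s0.
  by have := TM e (w' * (e * g)); rewrite wg' T_e.
have Pwg : P (w' * (e * g)) = 1.
  by have := cocycleM cc s0 e (w' * (e * g)); rewrite wg' T_e P_e mul1g.
exists (w * (e * g)); split.
- by rewrite TM Tww -TM.
- rewrite (cocycleM cc) Tww; congr (_ * _); apply: (mulgI (P w')).
  by rewrite -(cocycleM cc) Pwg mulgV.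
- rewrite piM.2; congr (_ * _); apply: (mulgI (pi w')).
  by rewrite mulgV -piM.2 -[LHS]mul1g -pie -piM.2 wg' pie.
- by rewrite -!mulgA ge.
Qed.

Lemma holonomy_in w : T w = s0 -> w * e = w -> pi w = 1 -> exists n, ga n = P w.
Proof.
move=> Tw we piw; have [n vnE] : exists n, v n = e * w.
  by apply/vP; rewrite mulgA ee -mulgA we piM.2 pie mul1g.
by exists n; rewrite vnE (cocycleM cc) T_e P_e mul1g.
Qed.

(** The quotient of [w] and [w'] lies in [N] up to left multiplication by [e]. *)
Lemma holonomy_null w w' : T w = T w' -> pi w = pi w' ->
  exists n, ga n = P w * (P w')^-1.
Proof.
move=> Tww piww; have [q [Tq Pq piq qe]] := holonomy_quotient Tww.
by rewrite -Pq; apply: holonomy_in => //; rewrite piq piww mulgV.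
Qed.

(** Conjugation by the quotient of [w] and [w'], which need not be in [N],
    preserves [N]. *)
Lemma holonomy_conj w w' l n : T w = T w' -> ga n = P w' * l * (P w')^-1 ->
  exists n', ga n' = P w * l * (P w)^-1.
Proof.
move=> Tww gan; have [q [Tq Pq piq qe]] := holonomy_quotient Tww.
have [r [Tr Pr pir re]] := holonomy_quotient (esym Tww).
have [n' n'E] : exists n', ga n' = P (q * v n * r).
  apply: holonomy_in.
  - by rewrite !TM Tq fixs0.
  - by rewrite -mulgA re.
  - have [_ _ pin] := vn n.
    by rewrite !piM.2 pin piq pir mulg1 -mulgA mulKg mulgV.
exists n'; rewrite n'E (cocycleM cc) TM Tq fixs0 (cocycleM cc) Tq Pq gan Pr.
by rewrite !mulgA mulgKV -!mulgA mulKg.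
Qed.

End Holonomy.

Variables (x0 y0 : X).
Hypothesis xy : x0 != y0.

(** Applied twice: to the images under [pi] of the words [y0 x0^(m+jd) y0],
    [j = 0, 1, 2], and to their unmodified outputs. *)
Lemma quotient_shift (G : groupType) (a b x : G) :
  a * b * (a * x * b)^-1 = a * x * b * (a * x * x * b)^-1.
Proof. by rewrite !invgM !mulgA !mulgK. Qed.

Lemma clock_exists (M : monoidType) (h : F -> M) (R : nat) :
  (exists A, H A) -> bar H M -> monoid_morphism h -> locally_constant f h ->
  exists q : F -> timer R,
    [/\ monoid_morphism q, locally_constant f q, bar H (M * timer R)%type,
       q (iota x0) = (false, tick R 0 1) & q (iota y0) = (true, ord0)].
Proof.
move=> HA barM hM hlc; have barMR := prod_timer_bar R VH HE HA barM.
pose tau z := (1, if z == x0 then (false, tick R 0 1) else (true, ord0)) : (M * timer R)%type.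
have [g [[g1 gM] glc gt]] := free_finite Ffree Fcpt cone tau barMR.
exists (fun w => (g w).2); split=> //.
- by split=> [|w w']; rewrite ?g1 ?gM.
- by have [i gi] := glc; exists i => w w' /gi ->.
- by rewrite gt /= eqxx.
- by rewrite gt /= eq_sym (negbTE xy).
Qed.

(** The representing automaton of [ga] is run together with a clock, and its
    output at the letter [y0] is modified at the state [ss] and time [m].  The
    inserted element [l'] is conjugate to [l] by the output of the path from the
    base state to [ss], so that it is [l] itself that becomes an output of [N]. *)
Lemma enlarge (A : finGroupType) (B : groupType) (al : A -> B) (ga : N -> A) (l : A) :
  H A -> {morph al : x y / x * y} -> {morph ga : x y / x * y} -> locally_constant_on ga ->
  al l = 1 ->
  exists ga1 : N -> A,
    [/\ {morph ga1 : x y / x * y}, locally_constant_on ga1, forall n, al (ga1 n) = al (ga n),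
      forall n, exists n', ga1 n' = ga n & exists n', ga1 n' = l].
Proof.
move=> HA alM gaM galc all.
have [M [h [Om [act [s0 [b [barM hM hlc fixs0 rep]]]]]]] :=
  cocycle_represents VH Ffree Fcpt cone vM v1 gaM galc.
have [c cc] := cocycle_exists VH HE Ffree Fcpt cone act b HA barM hM hlc.
have gaE n : c s0 (v n) = ga n by exact: rep.
pose yx k : F := iota y0 * iota x0 ^+ k.
pose sg k := act s0 (h (yx k)).
have yxD k j : yx (k + j)%N = yx k * iota x0 ^+ j by rewrite /yx expgnDr mulgA.
have sgD k j : sg (k + j)%N = act (sg k) (h (iota x0 ^+ j)).
  by rewrite /sg yxD hM.2 ractM.
have [k [d [d0 sgkd]]] := finite_repeat sg finite_finset.
(* Large enough for the clock not to be stuck at either of the times [k], [k + d]. *)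
pose R := (k + d).+1.
have [q [qM qlc barMR qx qy]] := clock_exists R (ex_intro _ A HA) barM hM hlc.
pose t0 := (q e).2.
have qe1 : (q e).1.
  have [a [a' ->]] := ediv (iota y0); rewrite !qM.2 qy.
  case q1: (q a').1; first by rewrite timer_reset.
  by rewrite timer_tick //= timer_reset.
(* The time of the insertion must differ from the time [t0] at the base state:
   otherwise the first letter of [y0 x0^m] could itself be modified. *)
have [m [mt0 mR sgmd]] : exists m, [/\ m != t0 :> nat, (m < R)%N & sg (m + d)%N = sg m].
  have [kt0|kt0] := eqVneq k (t0 : nat); last first.
    by exists k; split=> //; rewrite ltnS leq_addr.
  exists (k + d)%N; split=> //; last by rewrite sgD sgkd -sgD.
  by rewrite -kt0 -[X in _ != X]addn0 eqn_add2l -lt0n.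
pose ss := sg m; pose am := c s0 (yx m); pose l' := am^-1 * l * am.
pose G := (M * timer R)%type; pose g w : G := (h w, q w).
have gM : monoid_morphism g.
  by split=> [|w w']; rewrite /g ?hM.1 ?qM.1 // hM.2 qM.2.
have glc : locally_constant f g.
  have [i [hi qi]] := lc_common cone hlc qlc.
  by exists i => w w' ww; rewrite /g (hi _ _ ww) (qi _ _ ww).
pose act2_fun (s : Om * 'I_R.+1) (u : G) := (act s.1 u.1, timer_act s.2 u.2).
have act21 s : act2_fun s 1 = s.
  by rewrite /act2_fun ract1 timer_act1 -surjective_pairing.
have act2M s u u' : act2_fun s (u * u') = act2_fun (act2_fun s u) u'.
  by rewrite /act2_fun ractM timer_actM.
pose act2 := RightAction act21 act2M.
pose a2 (s : Om * 'I_R.+1) z :=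
  if [&& s.1 == ss, s.2 == m :> nat & z == y0] then l' * b s.1 z else b s.1 z.
have [c2 cc2] := cocycle_exists VH HE Ffree Fcpt cone act2 a2 HA barMR gM glc.
pose S0 := (s0, t0).
have fixS0 n : act2 S0 (g (v n)) = S0.
  have [_ vne _] := vn n.
  rewrite /act2 /= /act2_fun /= fixs0; congr (_, _).
  by rewrite -vne qM.2 /timer_act mulgA timer_reset.
pose P w := c2 S0 w; pose T w := act2 S0 (g w).
have TM w w' : T (w * w') = act2 (T w) (g w') by rewrite /T gM.2 ractM.
have PM w w' : P (w * w') = P w * c2 (T w) w' by rewrite /P (cocycleM cc2).
have T1 w : (T w).1 = act s0 (h w) by [].
pose ga1 n := P (v n).
exists ga1.
have ga1M : {morph ga1 : x y / x * y} := cocycle_morph cc2 fixS0.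
have xk2 j (s : Om) (t : 'I_R.+1) : act2 (s, t) (g (iota x0 ^+ j)) =
    (act s (h (iota x0 ^+ j)), tick R t j).
  congr (_, _); rewrite /timer_act /=.
  have -> : q (iota x0 ^+ j) = (false, tick R 0 j).
    elim: j => [|j IH]; last first.
      rewrite expgSr qM.2 IH qx timer_tick //=; congr (_, _); apply: val_inj.
      by rewrite /= !tickE /R; lia.
    by rewrite expg0 qM.1; congr (_, _); apply: val_inj; rewrite /= tickE; lia.
  by rewrite timer_tick //=; apply: val_inj; rewrite /= !tickE; lia.
have cx2 j (s : Om) (t : 'I_R.+1) : c2 (s, t) (iota x0 ^+ j) = c s (iota x0 ^+ j).
  elim: j => [|j IH]; first by rewrite !expg0 (cocycle1 cc) (cocycle1 cc2).
  rewrite !expgSr (cocycleM cc) (cocycleM cc2) IH (cocycle_gen cc) (cocycle_gen cc2).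
  by rewrite /a2 (negbTE xy) !andbF xk2.
have y2 (s : Om) (t : 'I_R.+1) : act2 (s, t) (g (iota y0)) = (act s (h (iota y0)), ord0).
  by congr (_, _); rewrite /timer_act /= qy timer_reset.
have Tyx j : T (yx j) = (sg j, tick R 0 j).
  by rewrite /yx TM /T y2 xk2 -ractM -hM.2.
have Pyx j : P (yx j) = c s0 (yx j).
  rewrite /yx PM /T y2 cx2 (cocycleM cc) /P (cocycle_gen cc2) (cocycle_gen cc) /a2 /=.
  by rewrite [t0 == m :> nat]eq_sym (negbTE mt0) andbF.
have sgj j : sg (m + j * d)%N = ss.
  elim: j => [|j IH]; first by rewrite mul0n addn0.
  by rewrite mulSn addnCA addnC sgD IH -sgD sgmd.
pose C := c ss (iota x0 ^+ d).
have cj j : c s0 (yx (m + j * d)%N) = am * C ^+ j.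
  elim: j => [|j IH]; first by rewrite mul0n addn0 expg0 mulg1.
  by rewrite mulSn addnCA addnC yxD (cocycleM cc) IH -/(sg _) sgj expgSr mulgA.
pose W j := yx (m + j * d)%N * iota y0.
have TW j : T (W j) = (act ss (h (iota y0)), ord0).
  by rewrite /W TM Tyx y2 sgj.
have PW j : P (W j) = (if j == 0%N then l else 1) * am * C ^+ j * b ss y0.
  rewrite /W PM Pyx cj Tyx sgj (cocycle_gen cc2) /a2 /= !eqxx andbT.
  case: j => [|j] /=.
    rewrite tickE mul0n addn0 add0n (minn_idPl (ltnW mR)) eqxx.
    by rewrite expg0 !mulg1 /l' !mulgA mulgV mul1g.
  rewrite tickE ifN ?mul1g // add0n mulSn; apply/eqP; move: mR d0; rewrite /R; lia.
have TW01 : T (W 0%N) = T (W 1%N) by rewrite !TW.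
have TW12 : T (W 1%N) = T (W 2%N) by rewrite !TW.
(* [V] and [V'] are the quotients [W 0 / W 1] and [W 1 / W 2]. *)
have [V [TV PV piV _]] := holonomy_quotient cc2 gM fixS0 TW01.
have [V' [TV' PV' piV' _]] := holonomy_quotient cc2 gM fixS0 TW12.
have piVV : pi V = pi V'.
  rewrite piV piV' /W mul0n mul1n mulSn mul1n addn0 addnA !yxD !piM.2.
  exact: quotient_shift.
have [nl nlE] := holonomy_null cc2 gM fixS0 (etrans TV (esym TV')) piVV.
have ga1l : ga1 nl = l.
  have PVV : P V = l * P V'.
    rewrite /P PV PV' -!/(P _) !PW /= expg0 expg1 expg2 !mul1g mulg1 (mulgA am C C).
    by rewrite -(quotient_shift am (b ss y0) C) !mulgA.
  by rewrite /ga1 /P nlE -!/(P _) PVV mulgK.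
have ga1_1 : ga1 1 = 1 by apply: (mulgI (ga1 1)); rewrite -ga1M !mulg1.
(* Every path to the place of the insertion conjugates [l'] into the outputs of [N]. *)
have lconj w : T w = (ss, tick R 0 m) -> exists n, ga1 n = P w * l' * (P w)^-1.
  move=> Tw; have Tww : T w = T (yx m) by rewrite Tyx.
  apply: (holonomy_conj cc2 gM fixS0 Tww (n := nl)).
  have -> : c2 S0 (v nl) = l := ga1l.
  have -> : c2 S0 (yx m) = am := Pyx m.
  by rewrite /l' !mulgA mulgV mul1g -mulgA mulgV mulg1.
have all' : al l' = 1.
  by rewrite /l' !alM all mulg1 -alM mulVg; apply: (mulgI (al 1)); rewrite -alM !mulg1.
(* Old and new outputs differ by an output of [N]: each insertion along [w]
   contributes one of the conjugates of [l']. *)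
have D : forall w, (exists n, P w = ga1 n * c s0 w) /\ al (P w) = al (c s0 w).
  apply: (word_ind VH Ffree Fcpt cone).
  - have [i [ci c2i]] := lc_common cone (cocycle_lc1 s0 cc) (cocycle_lc1 S0 cc2).
    by exists i => w w' ww; rewrite /P (ci _ _ ww) (c2i _ _ ww).
  - rewrite /P (cocycle1 cc) (cocycle1 cc2); split=> //; exists 1.
    by rewrite ga1_1 mulg1.
  - move=> w z [[n Pn] alP].
    rewrite PM (cocycleM cc) (cocycle_gen cc) (cocycle_gen cc2) /a2 T1.
    case: ifP => [/and3P[/eqP s_ss /eqP tm /eqP zy]|_]; last first.
      by split; [exists n; rewrite Pn mulgA|rewrite !alM alP].
    have [|n' n'E] := lconj w.
      rewrite [T w]surjective_pairing T1 s_ss; congr (_, _); apply: ord_inj.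
      by rewrite tickE add0n (minn_idPl (ltnW mR)).
    split; last by rewrite alM (alM l') all' mul1g alP -alM.
    exists (n' * n); rewrite ga1M n'E -(mulgA _ (ga1 n)) (mulgA (ga1 n)) -Pn.
    by rewrite !mulgA mulgKV.
split=> //.
- exact: locally_constant_on_cocycle cc2.
- by move=> n; rewrite /ga1 (D _).2 gaE.
- move=> n; have [[n' n'E] _] := D (v n).
  exists (n'^-1 * n); rewrite ga1M [ga1 n]n'E mulgA -ga1M mulVg ga1_1 mul1g.
  exact: gaE.
- by exists nl.
Qed.

(** Take a weak solution and enlarge its image until it is everything: an element
    [a] outside the image agrees over [B] with some [ga0 n], so that
    [a * (ga0 n)^-1] can be added. *)
Lemma embedding (A B : finGroupType) (al : A -> B) (be : N -> B) :
  H A -> {morph al : x y / x * y} -> (forall b, exists a, al a = b) ->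
  {morph be : x y / x * y} -> locally_constant_on be -> (forall b, exists n, be n = b) ->
  exists ga : N -> A,
    [/\ {morph ga : x y / x * y}, locally_constant_on ga, forall n, al (ga n) = be n &
        forall a, exists n, ga n = a].
Proof.
move=> HA alM alonto beM belc beonto.
have [ga0 [ga0M ga0lc alga0]] := projective HA alM alonto beM belc.
pose im (ga : N -> A) := [set a | `[< exists n, ga n = a >]]%SET.
have [k] := ubnP (#|A| - #|im ga0|)%N.
elim: k => // k IH in ga0 ga0M ga0lc alga0 *; rewrite ltnS => le_k.
have [imT|] := eqVneq (im ga0) [set: A]%SET.
  exists ga0; split=> // a; have : a \in im ga0 by rewrite imT inE.
  by rewrite inE => /asboolP.
rewrite -finset.subTset => /subsetPn[a _ na].
have [n ben] := beonto (al a).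
have all : al (a * (ga0 n)^-1) = 1.
  by apply: (mulIg (al (ga0 n))); rewrite -alM mulgKV mul1g alga0 ben.
have [ga1 [ga1M ga1lc alga1 ga1im [n1 n1E]]] := enlarge HA alM ga0M ga0lc all.
have ltim : im ga0 \proper im ga1.
  apply/properP; split.
    apply/fintype.subsetP => b; rewrite !inE => /asboolP[m <-]; apply/asboolP.
    by have [m' <-] := ga1im m; exists m'.
  exists a => //; rewrite inE; apply/asboolP.
  by have [m mE] := ga1im n; exists (n1 * m); rewrite ga1M n1E mE mulgKV.
apply: (IH ga1) => // [m|]; first by rewrite alga1.
have := proper_card ltim; have := subset_leq_card (finset.subsetT (im ga1)).
rewrite cardsT; move: le_k; move: #|A| #|im ga0| #|im ga1| => i j l; lia.
Qed.

End Embedding.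

(** * A criterion of Iwasawa *)

(** Permutation groups serve as a countable set of representatives of the
    finite groups. *)
Lemma cayley (A : finGroupType) : exists n (rho : A -> 'S_n),
  injective rho /\ {morph rho : x y / x * y}.
Proof.
exists #|A|.
pose r a (i : 'I_#|A|) := enum_rank (enum_val i * a).
have rinj a : injective (r a).
  by move=> i j /enum_rank_inj /mulIg /enum_val_inj.
exists (fun a => perm (@rinj a)); split=> [a b ab|a b].
  have /(congr1 enum_val) := congr1 (fun s : {perm _} => s (enum_rank 1)) ab.
  by rewrite !permE /r !enum_rankK !mul1g.
by apply/permP => i; rewrite permM !permE /r enum_rankK mulgA.
Qed.

Section Iwasawa.
Variables (H : finGroupType -> Prop) (VH : group_variety H).
Variables (N : topGroupType) (S : proj_system (as_monoids H)).
Variables (f : forall i : idx S, N -> obj i).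
Hypothesis cone : limit_cone f.
Hypothesis nontrivial : exists2 A : finGroupType, H A & exists a : A, a != 1.
Hypothesis countable_levels : exists u : nat -> idx S, forall i, exists k,
  forall x y, f (u k) x = f (u k) y -> f i x = f i y.
Hypothesis embed : forall (A B : finGroupType) (al : A -> B) (be : N -> B),
  H A -> {morph al : x y / x * y} -> (forall b, exists a, al a = b) ->
  {morph be : x y / x * y} -> locally_constant f be -> (forall b, exists n, be n = b) ->
  exists ga : N -> A,
    [/\ {morph ga : x y / x * y}, locally_constant f ga, forall n, al (ga n) = be n &
        forall a, exists n, ga n = a].

Lemma morphism_one (A B : groupType) (g : A -> B) : {morph g : x y / x * y} -> g 1 = 1.
Proof. by move=> gM; apply: (mulgI (g 1)); rewrite -gM !mulg1. Qed.

Lemma morphism_inv (A B : groupType) (g : A -> B) :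
  {morph g : x y / x * y} -> forall x, g x^-1 = (g x)^-1.
Proof. by move=> gM x; apply: (mulgI (g x)); rewrite -gM !mulgV morphism_one. Qed.

Lemma image_group (D : finGroupType) (de : N -> D) :
  H D -> {morph de : x y / x * y} -> locally_constant f de ->
  exists (B : finGroupType) (be : N -> B),
    [/\ H B, {morph be : x y / x * y}, locally_constant f be,
        forall b, exists n, be n = b & forall n n', be n = be n' <-> de n = de n'].
Proof.
move=> HD deM [i dei]; pose im := [set d | `[< exists n, de n = d >]]%SET.
have imG : group_set im.
  apply/group_setP; split; first by rewrite inE; apply/asboolP; exists 1; exact: morphism_one.
  move=> _ _ /[!inE] /asboolP[n <-] /asboolP[n' <-]; apply/asboolP.
  by exists (n * n'); rewrite deM.
have de_in n : de n \in Group imG by rewrite inE; apply/asboolP; exists n.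
exists (subg_of (Group imG)), (fun n => subg (Group imG) (de n)); split.
- exact: variety_sub.
- by move=> n n'; rewrite deM subgM.
- by exists i => n n' /dei ->.
- move=> b; have := subgP b; rewrite inE => /asboolP[n nb].
  by exists n; rewrite nb sgvalK.
- by move=> n n'; split=> [/(congr1 sgval)|->//]; rewrite !subgK.
Qed.

(** A step towards a basis: the tuple [sY] only matters modulo the kernel
    of [sbe]. *)
Record stage := Stage {
  sB : finGroupType;
  sH : H sB;
  sbe : N -> sB;
  sM : {morph sbe : x y / x * y};
  slc : locally_constant f sbe;
  sonto : forall b, exists n, sbe n = b;
  sY : seq N;
  sgen : forall G : {group sB}, (forall y, y \in sY -> sbe y \in G) ->
    forall b, b \in G
}.

(** The tuple is read with default value [1], so the entries added in [s'] are
    required to be trivial in the quotient [s]. *)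
Definition extends (s s' : stage) : Prop :=
  (forall n n', sbe s' n = sbe s' n' -> sbe s n = sbe s n') /\
  forall i, sbe s (nth 1 (sY s') i) = sbe s (nth 1 (sY s) i).

Lemma extends_trans s1 s2 s3 : extends s1 s2 -> extends s2 s3 -> extends s1 s3.
Proof.
move=> [r12 e12] [r23 e23]; split=> [n n' /r23 /r12//|i].
by rewrite -e12; apply: r12.
Qed.

Lemma stage_exists : exists s : stage, True.
Proof.
have [A HA _] := nontrivial.
have [i0] := idx_inhabited S.
have cM : {morph (fun _ : N => 1 : A) : x y / x * y >-> x * y} by move=> x y; rewrite mulg1.
have clc : locally_constant f (fun _ : N => 1 : A) by exists i0.
have [B [be [HB beM belc beonto be1]]] := image_group HA cM clc.
suff gen (G : {group B}) : (forall y, y \in [::] -> be y \in G) -> forall b, b \in G.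
  by exists (Stage HB beM belc beonto gen).
move=> _ b; have [n <-] := beonto b.
by have -> : be n = be 1; [exact/be1|rewrite (morphism_one beM) group1].
Qed.

(** Generators of the kernel of the new quotient over the old one are appended
    to the tuple; padding by [1] makes it as long as desired. *)
Lemma stage_refine (s : stage) (D : finGroupType) (de : N -> D) :
  H D -> {morph de : x y / x * y} -> locally_constant f de ->
  forall r, exists s', [/\ extends s s', forall n n', sbe s' n = sbe s' n' -> de n = de n' &
    (r <= size (sY s'))%N].
Proof.
move=> HD deM delc r; have [HBs bM blc] := And3 (sH s) (@sM s) (slc s).
pose g n := (sbe s n, de n).
have gM : {morph g : x y / x * y} by move=> x y; rewrite /g bM deM.
have glc : locally_constant f g.
  have [i [bi di]] := lc_common cone blc delc.
  by exists i => x y xy; rewrite /g (bi _ _ xy) (di _ _ xy).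
have [B [be [HB beM belc beonto beg]]] := image_group (variety_prod VH HBs HD) gM glc.
have bes n n' : be n = be n' -> sbe s n = sbe s n' by move=> /beg[].
have [rep repK] := choice beonto.
pose Y := sY s ++ [seq rep b | b <- enum B & sbe s (rep b) == 1] ++ nseq r 1.
have gen (G : {group B}) : (forall y, y \in Y -> be y \in G) -> forall b, b \in G.
  move=> YG.
  have pM : {morph (fun b => sbe s (rep b)) : x y / x * y}.
    by move=> b c; rewrite -bM; apply: bes; rewrite beM !repK.
  pose pm := Morphism (D := [set: B]%SET) (fun x y _ _ => pM x y).
  have inG n : sbe s n = 1 -> be n \in G.
    move=> n1; rewrite -[be n]repK; apply: YG; rewrite !mem_cat.
    apply/orP; right; apply/orP; left; apply/mapP; exists (be n) => //.
    rewrite mem_filter mem_enum andbT -n1; apply/eqP/bes; exact: repK.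
  move=> b; have [n <-] := beonto b.
  have : sbe s n \in (pm @* G)%G.
    apply: sgen => y ys; apply/morphimP; exists (be y); rewrite ?inE//.
      by apply: YG; rewrite mem_cat ys.
    by apply: bes; rewrite repK.
  move=> /morphimP[c _ cG nE]; have [m cE] := beonto c.
  rewrite -[n](mulgKV m) beM groupM// ?cE//.
  apply: inG; rewrite bM (morphism_inv bM) nE /= -cE.
  by rewrite (bes _ m (repK _)) mulgV.
exists (Stage HB beM belc beonto gen); split=> [|n n' /beg[]//|] /=; last first.
  by rewrite !size_cat size_nseq addnA leq_addl.
split=> //= i; rewrite nth_cat; case: ltnP => // le_i.
rewrite [in RHS]nth_default// (morphism_one bM) nth_cat.
case: ltnP => lt_i; last by rewrite nth_nseq; case: ifP; rewrite (morphism_one bM).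
have := mem_nth 1 lt_i => /mapP[b]; rewrite mem_filter => /andP[/eqP b1 _] ->.
exact: b1.
Qed.

(** The prescribed values and the old tuple together generate a subgroup [C] of
    [A * sB s] which projects onto [sB s]; a surjective solution [ga] of this
    embedding problem is the new quotient, and its first component is [psi]. *)
Lemma stage_solve (s : stage) (A : finGroupType) (tau : seq A) :
  H A -> (size tau <= size (sY s))%N ->
  exists s' (psi : N -> A), [/\ extends s s', {morph psi : x y / x * y},
    locally_constant f psi, forall n n', sbe s' n = sbe s' n' -> psi n = psi n' &
    forall i, psi (nth 1 (sY s') i) = nth 1 tau i].
Proof.
move=> HA le_tau; have [HBs bM blc] := And3 (sH s) (@sM s) (slc s).
pose pr i : A * sB s := (nth 1 tau i, sbe s (nth 1 (sY s) i)).
pose gens := [set pr i | i : 'I_(size (sY s))]%SET.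
pose C := <<gens>>%G.
have prC i : (i < size (sY s))%N -> pr i \in C.
  by move=> lt_i; apply: mem_gen; apply/imsetP; exists (Ordinal lt_i).
have HC : H (subg_of C) by apply: variety_sub => //; exact: variety_prod.
pose al (c : subg_of C) : sB s := (sgval c).2.
have alM : {morph al : x y / x * y} by [].
have alonto b : exists c, al c = b.
  have sndM : {morph (snd : A * sB s -> sB s) : x y / x * y} by [].
  pose sndm := Morphism (D := [set: (A * sB s)%type]%SET) (fun x y _ _ => sndM x y).
  have : b \in (sndm @* C)%G.
    apply: sgen => y ys; apply/morphimP; exists (pr (index y (sY s))); rewrite ?inE//.
      by apply: prC; rewrite index_mem.
    by rewrite /= nth_index.
  move=> /morphimP[c _ cC ->]; exists (subg C c).
  by rewrite /al subgK.
have [ga [gaM galc alga gaonto]] := embed HC alM alonto bM blc (@sonto s).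
have [rep repK] := choice gaonto.
pose Y := mkseq (fun i => rep (subg C (pr i))) (size (sY s)).
have gaY i : (i < size (sY s))%N -> sgval (ga (nth 1 Y i)) = pr i.
  by move=> lt_i; rewrite nth_mkseq// repK subgK// prC.
have gen (G : {group subg_of C}) : (forall y, y \in Y -> ga y \in G) -> forall b, b \in G.
  move=> YG b; suff CG : C \subset sgval @* G.
    have /morphimP[c _ cG /val_inj->//] := fintype.subsetP CG _ (subgP b).
  rewrite gen_subG; apply/fintype.subsetP => _ /imsetP[[i lt_i] _ ->] /=.
  rewrite -gaY//; apply: mem_morphim; first by rewrite inE.
  by apply: YG; rewrite mem_nth// size_mkseq.
have sgM : {morph (fun n => sgval (ga n)) : x y / x * y} by move=> x y; rewrite gaM.
exists (Stage HC gaM galc gaonto gen), (fun n => (sgval (ga n)).1); split=> //=.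
- split=> [n n' /= /(congr1 al)|i /=]; first by rewrite !alga.
  case: (ltnP i (size (sY s))) => lt_i; last by rewrite !nth_default// size_mkseq.
  by rewrite -alga /al gaY.
- by move=> x y; rewrite sgM.
- by have [i gi] := galc; exists i => x y /gi ->.
- by move=> n n' ->.
- move=> i; case: (ltnP i (size (sY s))) => lt_i; first by rewrite gaY.
  rewrite !nth_default ?size_mkseq// ?(leq_trans le_tau)//.
  by rewrite (morphism_one sgM).
Qed.

Lemma level_group i : exists (D : finGroupType) (de : N -> D),
  [/\ H D, {morph de : x y / x * y}, locally_constant f de &
      forall n n', de n = de n' <-> f i n = f i n'].
Proof.
have [f1 fM] := level_morph cone i.
have [D HD [j [jinj jM rj]]] := objP i.
have /choice[de deE] n : exists d, j d = f i n.
  have : [set: obj i] (f i n) by [].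
  by rewrite -rj => -[d _ <-]; exists d.
exists D, de; split=> //.
- by move=> x y; apply: jinj; rewrite jM !deE fM.
- by exists i => x y xy; apply: jinj; rewrite !deE.
- by move=> n n'; rewrite -!deE; split=> [->//|/jinj].
Qed.

(** A task is a finite tuple of permutations: the tuple in [N] has to be mapped
    to it, if the group that it generates is in [H]. *)
Definition solves (s : stage) (t : {d : nat & seq 'S_d}) : Prop :=
  let A := <<[set x in tagged t]%SET>>%G in H (subg_of A) ->
  exists psi : N -> 'S_(tag t), [/\ {morph psi : x y / x * y},
    locally_constant f psi, forall n n', sbe s n = sbe s n' -> psi n = psi n',
    forall n, psi n \in A & forall i, psi (nth 1 (sY s) i) = nth 1 (tagged t) i].

Lemma stage_step (s : stage) i (t : option {d : nat & seq 'S_d}) : exists s',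
  [/\ extends s s', forall n n', sbe s' n = sbe s' n' -> f i n = f i n' &
      if t is Some t then solves s' t else True].
Proof.
have [D [de [HD deM delc def]]] := level_group i.
have [s1 [ss1 s1de]] := stage_refine s HD deM delc
  (if t is Some t then size (tagged t) else 0%N).
case: t => [[d l]|_]; last first.
  by exists s1; split=> // n n' /s1de /def.
rewrite /= => le_l; pose A := <<[set x in l]%SET>>%G.
have [HA|nHA] := pselect (H (subg_of A)); last first.
  by exists s1; split=> // n n' /s1de /def.
have lA x : x \in l -> x \in A by move=> xl; rewrite mem_gen// inE.
have [|s2 [psi [s12 psiM psilc psis psil]]] := @stage_solve s1 _ (map (subg A) l) HA.
  by rewrite size_map.
exists s2; split.
- exact: extends_trans s12.
- by move=> n n' /s12.1 /s1de /def.
- move=> _; exists (fun n => sgval (psi n)); split=> /=.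
  + by move=> x y; rewrite psiM.
  + by have [j pj] := psilc; exists j => x y /pj ->.
  + by move=> n n' /psis ->.
  + by move=> n; exact: subgP.
  + move=> j; rewrite psil; case: (ltnP j (size l)) => lt_j.
      by rewrite (nth_map 1)// subgK// lA// mem_nth.
    by rewrite !nth_default ?size_map.
Qed.

(** The [k]-th stage takes care of the [k]-th level and of the [k]-th task; [y]
    is the limit of the tuples. *)
Lemma basis_exists : exists y : nat -> N,
  [/\ forall i, exists m, forall k, (m <= k)%N -> f i (y k) = 1,
      forall (P : N -> Prop) i, P 1 -> (forall a b, P a -> P b -> P (a * b)) ->
        (forall a, P a -> P a^-1) -> (forall k, P (y k)) ->
        forall n, exists2 m, P m & f i m = f i n &
      forall (A : finGroupType) (tau : seq A), H A -> exists psi : N -> A,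
        [/\ {morph psi : a b / a * b}, locally_constant f psi &
            forall k, psi (y k) = nth 1 tau k]].
Proof.
have [u uP] := countable_levels; have [s0 _] := stage_exists.
pose task k := choice.unpickle k : option {d : nat & seq 'S_d}.
have /choice[next nextP] (ks : nat * stage) := stage_step ks.2 (u ks.1) (task ks.1).
pose st := fix st k := if k is j.+1 then next (j, st j) else s0.
have stS k : extends (st k) (st k.+1) by have [] := nextP (k, st k).
have st_le k l : (k <= l)%N -> extends (st k) (st l).
  move=> /subnK <-; elim: (l - k)%N => [|j IH]; first by split.
  by rewrite addSn; exact: extends_trans IH (stS _).
pose covers k i := forall n n', sbe (st k) n = sbe (st k) n' -> f i n = f i n'.
have coversW k l i : (k <= l)%N -> covers k i -> covers l i.
  by move=> /st_le[kl _] ki n n' /kl /ki.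
have cov i : exists k, covers k i.
  have [k kP] := uP i; exists k.+1 => n n' nn'; apply: kP.
  by have [_ /(_ n n' nn')] := nextP (k, st k).
have approx k l i j : covers k i -> covers l i ->
    f i (nth 1 (sY (st k)) j) = f i (nth 1 (sY (st l)) j).
  move=> ki li; case/orP: (leq_total k l) => [kl|lk].
    by apply/esym/ki; have [_ ->] := st_le _ _ kl.
  by apply: li; have [_ ->] := st_le _ _ lk.
have [_ fc _ fsurj fnbhs] := cone.
have [c cP] := choice cov.
have /choice[y yP] j : exists y, forall i, f i y = f i (nth 1 (sY (st (c i))) j).
  apply: fsurj => i i' ii'; rewrite fc//; apply: approx => //.
  by move=> n n' /cP E; rewrite -!(fc _ _ _ ii') E.
have sbe_y k j : sbe (st k) (y j) = sbe (st k) (nth 1 (sY (st k)) j).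
  have [i ki] := slc (st k); pose l := maxn k (c i).
  have li : covers l i by apply: coversW (cP i); exact: leq_maxr.
  rewrite (ki _ (nth 1 (sY (st l)) j)); last by rewrite yP; exact: approx.
  by have [_ ->] := st_le _ _ (leq_maxl k (c i)).
exists y; split.
- move=> i; exists (size (sY (st (c i)))) => k le_k.
  by rewrite yP nth_default//; have [->] := level_morph cone i.
- move=> P i P1 PM PV Py n; set k := c i.
  pose G := [set b | `[< exists2 m, P m & sbe (st k) m = b >]]%SET.
  have GG : group_set G.
    apply/group_setP; split.
      by rewrite inE; apply/asboolP; exists 1 => //; exact: morphism_one (@sM _).
    move=> _ _ /[!inE] /asboolP[a Pa <-] /asboolP[b Pb <-]; apply/asboolP.
    by exists (a * b); [exact: PM|exact: sM].
  have : sbe (st k) n \in Group GG.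
    apply: sgen => z zY; rewrite inE; apply/asboolP.
    by exists (y (index z (sY (st k)))) => //; rewrite sbe_y nth_index.
  by rewrite inE => /asboolP[m Pm mE]; exists m => //; exact: cP mE.
- move=> A tau HA; have [d [rho [rinj rM]]] := cayley A.
  pose t : {d : nat & seq 'S_d} := Tagged (fun d => seq 'S_d) (map rho tau).
  have [_ _] := nextP (choice.pickle t, st (choice.pickle t));
  rewrite /task /= choice.pickleK => sol.
  set C := <<[set x in map rho tau]%SET>>%G.
  have Crho x : x \in C -> exists a, rho a = x.
    pose rm := Morphism (D := [set: A]%SET) (fun x y _ _ => rM x y).
    have CG : C \subset rm @* [set: A]%SET.
      rewrite gen_subG; apply/fintype.subsetP => z; rewrite inE => /mapP[a _ ->].
      by apply: (mem_morphim rm); rewrite inE.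
    by move=> /(fintype.subsetP CG)/morphimP[a _ _ ->]; exists a.
  have HC : H (subg_of C).
    have /choice[g gP] (x : subg_of C) : exists a, rho a = sgval x by exact/Crho/subgP.
    apply: (@variety_inj _ VH _ _ g) HA => [x z xz|x z].
      by apply: val_inj; rewrite /= -!gP xz.
    by apply: rinj; rewrite rM !gP.
  have [psi [psiM [i psii] psis psiC psit]] := sol HC.
  have /choice[g gP] n : exists a, rho a = psi n by exact/Crho/psiC.
  exists g; split.
  + by move=> a b; apply: rinj; rewrite rM !gP.
  + by exists i => a b /psii ab; apply: rinj; rewrite !gP.
  + move=> k; apply: rinj; rewrite gP.
    have /psis -> := sbe_y (choice.pickle t).+1 k.
    rewrite psit /=; case: (ltnP k (size tau)) => lt_k; first by rewrite (nth_map 1).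
    by rewrite !nth_default ?size_map// (morphism_one rM).
Qed.

Lemma cmorph_eq (M M' : topMonoidType) (g h : cmorph M M') : (forall x, g x = h x) -> g = h.
Proof.
case: g h => [g gM gc] [h hM hc] /= gh.
have gh' : g = h by exact: functional_extensionality_dep.
by subst h; congr CMorph; exact: Prop_irrelevance.
Qed.

(** The coordinates of a homomorphism to [K] are obtained from the third property
    of [y], and fit together since they agree on [y], which generates.  The
    members of [y] are distinct because a nontrivial group in [H] separates them. *)
Lemma iwasawa : free_pro_group_of_countable_rank H N.
Proof.
have [y [ycvg ygen yext]] := basis_exists.
have [_ _ _ _ fnbhs] := cone.
have agree (M : monoidType) (g h : N -> M) : monoid_morphism g -> monoid_morphism h ->
    locally_constant f g -> locally_constant f h -> (forall k, g (y k) = h (y k)) ->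
    forall n, g n = h n.
  move=> [g1 gM] [h1 hM] glc hlc gh n.
  have [i [gi hi]] := lc_common cone glc hlc.
  have E1 : g 1 = h 1 by rewrite g1 h1.
  have EM a b : g a = h a -> g b = h b -> g (a * b) = h (a * b).
    by move=> ga gb; rewrite gM hM ga gb.
  have EV a : g a = h a -> g a^-1 = h a^-1.
    by move=> ga; rewrite -[LHS]mulg1 -h1 -(mulgV a) hM mulgA -ga -gM mulVg g1 mul1g.
  have [m mP mn] := ygen (fun n => g n = h n) i E1 EM EV gh n.
  by rewrite -(gi _ _ mn) -(hi _ _ mn).
have yinj : injective y.
  have [A HA [a a1]] := nontrivial.
  move=> i j yij; apply/eqP; apply: contraT => ij.
  have [psi [_ _ psiy]] := yext A (rcons (nseq i 1) a) HA.
  have := psiy j; rewrite -yij psiy !nth_rcons !size_nseq ltnn eqxx nth_nseq.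
  rewrite [j == i]eq_sym (negbTE ij) if_same.
  by case: ifP => _ a1'; rewrite a1' eqxx in a1.
pose Y := range y.
have Yy k : Y (y k) by exists k.
pose yY k : Y := SigSub (mem_set (Yy k)).
have yYonto (z : Y) : exists k, z = yY k.
  have [k _ kz] := set_valP z; exists k; apply: val_inj; exact: esym kz.
exists Y; first by apply: inj_card_eq => i j _ _; exact: yinj.
split.
- by exists S; apply/proj_limitP; exists f.
- move=> U /fnbhs[i iU]; have [m mP] := ycvg i.
  apply: (@sub_finite_set _ _ [set yY k | k in `I_m]).
    move=> z nUz; have [k zk] := yYonto z; exists k => //=.
    rewrite ltnNge; apply/negP => /mP fk; apply: nUz; apply: iU.
    by rewrite zk /= fk; have [->] := level_morph cone i.
  by apply: finite_image; exact: finite_II.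
- move=> K [S' /proj_limitP[g gcone]] tau taucvg.
  have [gM gc ginj gsurj gnbhs] := gcone.
  have phi_ex j : exists phi : N -> obj j, [/\ monoid_morphism phi,
      locally_constant f phi & forall k, phi (y k) = g j (tau (yY k))].
    have [D HD [w [winj wM rw]]] := objP j.
    have w1 : w 1 = 1.
      have : [set: obj j] 1 by [].
      rewrite -rw => -[d _ wd]; rewrite -[LHS]mulg1 -wd -wM mul1g wd.
      by [].
    have /choice[de deE] k : exists d, w d = g j (tau (yY k)).
      have : [set: obj j] (g j (tau (yY k))) by [].
      by rewrite -rw => -[d _ <-]; exists d.
    have [m mP] : exists m, forall k, (m <= k)%N -> de k = 1.
      have /taucvg fin : nbhs 1 [set x | g j x = 1].
        by apply/gnbhs; exists j => x /= ->; have [->] := gM j.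
      have : finite_set [set k | de k != 1].
        have -> : [set k | de k != 1] = yY @^-1` [set i | ~ g j (tau i) = 1].
          apply/seteqP; split=> k /= dk.
            by move/eqP: dk => dk gk; apply: dk; apply: winj; rewrite deE gk w1.
          by apply/eqP => dk1; apply: dk; rewrite -deE dk1 w1.
        by apply: finite_preimage fin => k l _ _ /(congr1 val) /yinj.
      move=> /finite_seqP[l lE]; exists (\max_(k <- l) k).+1 => k lt_k.
      apply/eqP; apply: contraT => dk.
      have : k \in l by have : [set k | de k != 1] k by []; rewrite lE.
      by move=> kl; move: lt_k; rewrite ltnNge (leq_bigmax_seq (F := id)).
    have [psi [psiM [i psii] psiy]] := yext D (mkseq de m) HD.
    exists (w \o psi); split.
    + split=> [|a b] /=; last by rewrite psiM wM.
      by rewrite (morphism_one psiM).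
    + by exists i => a b /psii /= ->.
    + move=> k; rewrite /= psiy -deE; congr w.
      case: (ltnP k m) => lt_k; first by rewrite nth_mkseq.
      by rewrite nth_default ?size_mkseq// mP.
  pose phi j := sval (cid (phi_ex j)).
  have phiP j : [/\ monoid_morphism (phi j), locally_constant f (phi j) &
      forall k, phi j (y k) = g j (tau (yY k))] := svalP (cid (phi_ex j)).
  have /choice[Phi PhiE] n : exists x, forall j, g j x = phi j n.
    apply: gsurj => i j ij; have [[pi1 piM] [l pil] piy] := phiP i.
    have [[pj1 pjM] [m pjm] pjy] := phiP j.
    have [c1 cM] := conn_morph ij.
    apply: (agree _ (fun n => conn i (phi j n)) (phi i)) => //.
    + by split=> [|a b]; rewrite ?pj1 ?pjM.
    + by exists m => a b /pjm ->.
    + by exists l.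
    + by move=> k; rewrite pjy piy gc.
  have Phi_morph : monoid_morphism Phi.
    split=> [|a b]; apply: ginj => j; have [[p1 pM] _ _] := phiP j;
      have [g1 gjM] := gM j.
      by rewrite PhiE p1 g1.
    by rewrite PhiE pM gjM !PhiE.
  have Phi_cont : continuous Phi.
    move=> n U /gnbhs[j jU]; have [_ [i pi] _] := phiP j.
    by apply/fnbhs; exists i => m /pi mn; apply: jU; rewrite !PhiE.
  exists (CMorph Phi_morph Phi_cont); split=> [z|Psi PsiE].
    have [k ->] := yYonto z; apply: ginj => j /=.
    by rewrite PhiE; have [_ _ ->] := phiP j.
  apply: cmorph_eq => n; apply: ginj => j /=.
  have [Psi1 PsiM] := cmorphP Psi; have [g1 gjM] := gM j.
  rewrite PhiE; have [pM plc py] := phiP j.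
  apply: (agree _ (phi j) (fun n => g j (Psi n))) => //.
  + by split=> [|a b]; rewrite ?Psi1 ?PsiM.
  + have nb : nbhs (Psi 1) [set x | g j x = 1] by rewrite Psi1; apply/gnbhs; exists j => x /= ->.
    have /fnbhs[i /= iP] := @cmorph_continuous _ _ Psi 1 _ nb; exists i => a b ab.
    have : g j (Psi (a * b^-1)) = 1.
      apply: iP; have [f1 fM] := level_morph cone i.
      by rewrite fM ab -fM mulgV.
    by move=> E; rewrite -[a](mulgKV b) PsiM gjM E mul1g.
  + by move=> k; rewrite py -PsiE.
Qed.

End Iwasawa.

(** * The kernel as a profinite group *)

(** A level is determined by the Cayley graph of its image of [X]: number the
    elements of [obj i] and record the number of [1] and the right multiplications
    by the letters.  Such codes form a countable set. *)
Lemma levels_countable (H : finGroupType -> Prop) (X : finType)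
  (F : topMonoidType) (iota : X -> F) (S : proj_system (bar H))
  (f : forall i : idx S, F -> obj i) :
  group_variety H -> free_pro (bar H) iota -> compact [set: F] -> limit_cone f ->
  exists u : nat -> idx S, forall i, exists k,
    forall x y, f (u k) x = f (u k) y -> f i x = f i y.
Proof.
move=> VH Ffree Fcpt cone.
have code_ex i : exists c : (nat * seq {ffun X -> nat}) * (obj i -> nat),
    [/\ injective c.2, c.2 1 = c.1.1 &
      forall m x, c.2 (m * f i (iota x)) = nth [ffun=> 0%N] c.1.2 (c.2 m) x].
  have [E [enc [dec [encK decK]]]] := finite_enum (objP i).1.
  pose h m := index (enc m) (enum E).
  exists (h 1, [seq [ffun x => h (dec t * f i (iota x))] | t <- enum E], h); split=> //=.
    move=> m m' mm'; apply: (can_inj encK).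
    by rewrite -(nth_index (enc m) (mem_enum E (enc m))) -/(h m) mm' nth_index ?mem_enum.
  move=> m x; rewrite (nth_map (enc m)) ?index_mem ?mem_enum//.
  by rewrite ffunE nth_index ?mem_enum// encK.
pose code i := (sval (cid (code_ex i))).1.
pose h i := (sval (cid (code_ex i))).2.
have hP i : [/\ injective (h i), h i 1 = (code i).1 &
  forall m x, h i (m * f i (iota x)) = nth [ffun=> 0%N] (code i).2 (h i m) x].
  exact: svalP (cid (code_ex i)).
have code_eq i j : code i = code j -> forall w, h i (f i w) = h j (f j w).
  move=> cij; have [_ hi1 hi] := hP i; have [_ hj1 hj] := hP j.
  have [fi1 fiM] := level_morph cone i; have [fj1 fjM] := level_morph cone j.
  apply: (word_ind VH Ffree Fcpt cone).
  - have [k [ki kj]] := lc_common cone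
      (ex_intro _ i (fun _ _ E => E) : locally_constant f (f i))
      (ex_intro _ j (fun _ _ E => E) : locally_constant f (f j)).
    by exists k => x y xy; rewrite (ki _ _ xy) (kj _ _ xy).
  - by rewrite fi1 fj1 hi1 hj1 cij.
  - by move=> w x IH; rewrite fiM fjM hi hj IH cij.
have [i0] := idx_inhabited S.
pose u k := if pselect (exists i, choice.pickle (code i) = k) is left P
  then sval (cid P) else i0.
exists u => i; exists (choice.pickle (code i)) => x y.
rewrite /u; case: pselect => [P|[]]; last by exists i.
case: (cid P) => j /= /(pcan_inj choice.pickleK) cji xy.
have [hi _ _] := hP i; apply: hi.
by rewrite -!(code_eq _ _ cji) xy.
Qed.

Lemma set_type_nbhs (T : topologicalType) (A : set T) (x : set_type A) (U : set (set_type A)) :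
  nbhs x U <-> exists2 V, nbhs (val x) V & forall y, V (val y) -> U y.
Proof.
split.
  rewrite nbhsE => -[_ [[B oB <-] Bx] BU]; exists B; first by exists B.
  by move=> y; exact: BU.
move=> [V Vx VU]; have nV : nbhs x (val @^-1` V) by exact: set_type_val_continuous Vx.
by apply: filterS nV => y; exact: VU.
Qed.

Section Kernel.
Variables (H : finGroupType -> Prop).
Variables (F : profiniteMonoidType) (K : topGroupType) (pi : cmorph F K).
Variables (S : proj_system (bar H)) (f : forall i : idx S, F -> obj i).
Hypothesis cone : limit_cone f.
Hypothesis Kpro : pro (as_monoids H) K.
Variable (e : idem_elt F).
Hypothesis einv : forall w : F, exists g : F,
  [/\ idem_val e * g = g, g * idem_val e = g, idem_val e * w * idem_val e * g = idem_val e &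
      g * (idem_val e * w * idem_val e) = idem_val e].

Local Notation N := (cmorph_ker (max_subgroup_res e pi)).

Definition kernel_val (n : N) : F := val (val n : max_subgroup e).
Local Notation v := kernel_val.

Lemma kernel_val_inj : injective v.
Proof. by move=> n n' /val_inj /val_inj. Qed.

Lemma kernel_valM : {morph v : x y / x * y}.
Proof. by []. Qed.

Lemma kernel_val1 : v 1 = idem_val e.
Proof. by []. Qed.

Lemma kernel_valP z : (exists n, v n = z) <->
  [/\ idem_val e * z = z, z * idem_val e = z & pi z = 1].
Proof.
split=> [[n <-]|[ez ze piz]].
  have [/cornerP[en ne] _] := set_valP (val n : max_subgroup e).
  by split=> //; exact: (set_valP n).
have uz : corner_units (idem_val e) z.
  split; first exact/cornerP.
  have [g [eg ge]] := einv z; rewrite ez ze => zg gz.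
  by exists g => //; exact/cornerP.
pose g : max_subgroup e := SigSub (mem_set uz).
have kg : [set g | max_subgroup_res e pi g = 1] g by [].
by exists (SigSub (mem_set kg)).
Qed.

Lemma kernel_nbhs n U : nbhs n U <-> exists i, forall n', f i (v n') = f i (v n) -> U n'.
Proof.
have [_ _ _ _ fnbhs] := cone.
split.
  move=> /(@set_type_nbhs (max_subgroup e))[V /(@set_type_nbhs F)[W /fnbhs[i iW] WV] VU].
  by exists i => n' n'n; apply/VU/WV/iW.
move=> [i iU]; apply/(@set_type_nbhs (max_subgroup e)).
exists [set g : max_subgroup e | f i (val g) = f i (v n)]; last by move=> n' /iU.
apply/(@set_type_nbhs F); exists [set w | f i w = f i (v n)] => //.
by apply/fnbhs; exists i.
Qed.

(** The levels of the kernel are the images of the kernel in the levels of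
    [F], which are groups in [H]; [r] and [r'] say that both systems of levels
    are the same.  A thread gives an element of [F] which is approximated by
    elements of the kernel, and it lies in the kernel because the kernel is closed. *)
Lemma kernel_cone : exists (S' : proj_system (as_monoids H))
    (f' : forall i : idx S', (N : topGroupType) -> obj i),
  limit_cone f' /\ exists (r : idx S -> idx S') (r' : idx S' -> idx S), 
   (forall i n n', f' (r i) n = f' (r i) n' <-> f i (v n) = f i (v n')) /\
   (forall i n n', f' i n = f' i n' <-> f (r' i) (v n) = f (r' i) (v n')).
Proof.
have [fM fc finj fsurj fnbhs] := cone.
have fvM i : {morph (fun n => f i (v n)) : x y / x * y}.
  by move=> x y; rewrite kernel_valM (fM i).2.
have de_ex i : exists D : {D : finGroupType & N -> D}, [/\ H (tag D),
   {morph tagged D : x y / x * y}, forall d, exists n, tagged D n = d &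
   forall n n', tagged D n = tagged D n' <-> f i (v n) = f i (v n')].
  have [D HD [w [winj wM rw]]] := (objP i).2 _ (range_is_subgroup (fvM i)).
  have /choice[de deE] n : exists d, w d = f i (v n).
    have : range (fun n => f i (v n)) (f i (v n)) by exists n.
    by rewrite -rw => -[d _ <-]; exists d.
  exists (Tagged (fun D : finGroupType => N -> D) de); split=> //=.
  - by move=> x y; apply: winj; rewrite wM !deE fvM.
  - move=> d; have : range w (w d) by exists d.
    by rewrite rw => -[n _ nd]; exists n; apply: winj; rewrite deE.
  - by move=> n n'; rewrite -!deE; split=> [->//|/winj].
pose D i : finGroupType := tag (sval (cid (de_ex i))).
pose de i : N -> D i := tagged (sval (cid (de_ex i))).
have deP i : [/\ H (D i), {morph de i : x y / x * y}, forall d, exists n, de i n = d &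
   forall n n', de i n = de i n' <-> f i (v n) = f i (v n')] := svalP (cid (de_ex i)).
have rep_ex i : exists rep : D i -> N, cancel rep (de i).
  by have [_ _ /choice[rep repK] _] := deP i; exists rep.
pose rep i := sval (cid (rep_ex i)).
have repK i : cancel (rep i) (de i) := svalP (cid (rep_ex i)).
have deW i j n n' : idx_le i j -> de j n = de j n' -> de i n = de i n'.
  move=> ij; have [_ _ _ ej] := deP j; have [_ _ _ ei] := deP i.
  by move=> /ej nn'; apply/ei; rewrite -!(fc _ _ _ ij) nn'.
pose cn i j (x : D j) : D i := de i (rep j x).
have cnde i j n : idx_le i j -> cn i j (de j n) = de i n.
  by move=> ij; apply: deW ij _; rewrite repK.
have de1 i : de i 1 = 1 by have [_ deM _ _] := deP i; exact: morphism_one.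
have cnM i j : idx_le i j -> monoid_morphism (cn i j).
  move=> ij; have [_ diM _ _] := deP i; have [_ djM _ _] := deP j.
  split=> [|x y]; first by rewrite -(de1 j) cnde// de1.
  by rewrite -[x](repK j) -[y](repK j) -djM !cnde.
have cn_id i (x : D i) : cn i i x = x by rewrite /cn repK.
have cnC i j k : idx_le i j -> idx_le j k -> forall x, cn i j (cn j k x) = cn i k x.
  by move=> ij jk x; rewrite {2}/cn cnde.
have HD i : as_monoids H (D i).
  exists (D i); first by have [] := deP i.
  by exists id; split=> //; apply/seteqP; split=> x // _; exists x.
pose S' := ProjSystem (@idx_le_refl _ S) (@idx_le_trans _ S) (idx_inhabited S)
  (@idx_directed _ S) HD cnM cn_id cnC.
exists S', de; split; last first.
  by exists id, id; split=> i; have [] := deP i.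
split.
- by move=> i; split; [exact: de1|have [] := deP i].
- by move=> i j n ij; exact: cnde.
- move=> n n' nn'; apply: kernel_val_inj; apply: finj => i.
  by have [_ _ _ ei] := deP i; apply/ei/nn'.
- move=> a aP; pose b i := f i (v (rep i (a i))).
  have [i j ij|z zP] := fsurj b.
    rewrite /b fc//; have [_ _ _ ei] := deP i; apply/ei.
    by rewrite repK; exact: aP.
  have [|n nz] := (kernel_valP z).2; last first.
    exists n => i; rewrite -[a i]repK; have [_ _ _ ei] := deP i; apply/ei.
    by rewrite nz zP.
  have vn i := (kernel_valP _).1 (ex_intro _ (rep i (a i)) erefl).
  split.
  + by apply: finj => i; have [ev _ _] := vn i; rewrite (fM i).2 zP -(fM i).2 ev.
  + by apply: finj => i; have [_ ve _] := vn i; rewrite (fM i).2 zP -(fM i).2 ve.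
  + have [S'' /proj_limitP[g [gM _ ginj _ gnbhs]]] := Kpro.
    apply: ginj => j.
    have nb : nbhs (pi z) [set x | g j x = g j (pi z)] by apply/gnbhs; exists j.
    have /fnbhs[i /= iP] := @cmorph_continuous _ _ pi z _ nb.
    have [_ _ piv] := vn i.
    by rewrite -(iP (v (rep i (a i)))) ?piv// zP.
- move=> n U; split=> [/kernel_nbhs|] [i iU].
    by exists i => n' n'n; apply: iU; have [_ _ _ ei] := deP i; apply/ei.
  apply/kernel_nbhs; exists i => n' n'n; apply: iU.
  by have [_ _ _ ei] := deP i; apply/ei.
Qed.

End Kernel.

Theorem theorem2
  (H : finGroupType -> Prop)
  (H_variety : group_variety H)
  (H_ext : extension_closed H)
  (H_primes : infinite_set [set p : nat | prime p /\ H 'Z_p]%classic)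
  (X : finType) (card_X : (1 < #|X|)%N)
  (F : profiniteMonoidType) (iota : X -> F)
  (F_free : free_pro (bar H) iota)
  (FH : topGroupType) (iotaH : X -> FH)
  (FH_free : free_pro (as_monoids H) iotaH)
  (pi : cmorph F FH) (pi_iota : forall x : X, pi (iota x) = iotaH x)
  (I : set F) (I_min : minimal_ideal I)
  (e : idem_elt F) (I_e : I (idem_val e)) :
  free_pro_group_of_countable_rank H (cmorph_ker (max_subgroup_res e pi)).
Proof.
have Fcpt : compact [set: F] by exact: profinite_compact.
have [[S /proj_limitP[f cone]] _] := F_free.
have [fM _ finj _ _] := cone.
have einv := minimal_corner_inverse I_min I_e (fun M => @proj1 _ _) fM finj (idemP e).
have [S' [f' [cone' [r [r' [rP r'P]]]]]] := kernel_cone pi cone FH_free.1 einv.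
have [x0 [y0 [_ _ xy]]] := card_gt1P card_X.
apply: (iwasawa H_variety cone').
- have /infinite_setN0[p [pr_p Hp]] := H_primes.
  apply: (ex_intro2 _ _ _ Hp). exists (1%R : 'Z_p). exact: GRing.oner_neq0.
- have [u uP] := levels_countable H_variety F_free Fcpt cone.
  exists (r \o u) => i; have [k kP] := uP (r' i).
  by exists k => x y /= /rP /kP /r'P.
- move=> A B al be HA alM alonto beM [i bei] beonto.
  have belc : locally_constant_on f (@kernel_val F FH pi e) be.
    by exists (r' i) => n n' /r'P /bei.
  have [ga [gaM [j gaj] alga gaonto]] := embedding H_variety H_ext F_free Fcpt cone
    (@kernel_valM F FH pi e) (@kernel_val1 F FH pi e) (cmorphP pi) (kernel_valP pi einv) einv
    (minimal_ideal_div I_min I_e) xy HA alM alonto beM belc beonto.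
  by exists ga; split=> //; exists (r j) => n n' /rP /gaj.
Qed.
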